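(* The following are equivalent over $\mathsf{RCA}_0$: 1. $\mathsf{ACA}_0$. 2. $\Sigma^0_1\text{-}\mathrm{WKL}(ext\text{-}bd)$: for every infinite $\Sigma^0_1$ tree $T\subseteq 2^{<\mathbb{N}}$, if there exists $c\in\mathbb{N}$ such that $|T_{\mathrm{ext}}^{=n}|\le c$ for all $n\in\mathbb{N}$, then $T$ has a path. 3. $\mathrm{KL}(ext\text{-}bd)$: for every infinite finitely-branching tree $T\subseteq \mathbb{N}^{<\mathbb{N}}$, if there exists $c\in\mathbb{N}$ such that $|T_{\mathrm{ext}}^{=n}|\le c$ for all $n\in\mathbb{N}$, then $T$ has a path.
   Context: $\mathsf{RCA}_0$ and $\mathsf{ACA}_0$ are the usual subsystems of second-order arithmetic; all statements are formulated in second-order arithmetic and the equivalences are provable in $\mathsf{RCA}_0$. A tree is a collection of finite sequences (from $2^{<\mathbb{N}}$ or $\mathbb{N}^{<\mathbb{N}}$) closed under initial segments; $\mathrm{lh}(\sigma)$ is the length of $\sigma$. In item 3, $T$ is a set, and finitely-branching means that each node has only finitely many immediate successors in $T$. A $\Sigma^0_1$ tree $T\subseteq 2^{<\mathbb{N}}$ need not exist as a set: it is given by an enumeration of binary strings $\{\sigma_i\}_{i\in\mathbb{N}}$ such that $T=\{\sigma_i\mid i\in\mathbb{N}\}$ is a tree. A path of $T$ is a function $f$ (existing as a second-order object) all of whose finite initial segments are in $T$. A node $\sigma\in T$ is extendible if it has extensions in $T$ of arbitrarily large length. $T_{\mathrm{ext}}^{=n}=\{\sigma\in T\mid \mathrm{lh}(\sigma)=n\text{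 and }\sigma\text{ is extendible}\}$. For a definable collection $A$ (not necessarily existing as a set), $|A|\le c$ means that every finite set $F\subseteq A$ (coded by a natural number) satisfies $|F|\le c$. *)

(* Defs.v *)
(* Uses Stdlib only: a deep embedding of the language L2 of second-order
   arithmetic, classical natural deduction for it, the theories RCA_0 and
   ACA_0, and the combinatorial principles as L2-sentences. *)
From Stdlib Require Import List.
Import ListNotations.

(* Number variables and set variables are two independent families of
   de Bruijn indices: a number quantifier binds number variable 0 and a set
   quantifier binds set variable 0. *)
Inductive term : Type :=
| tvar (n : nat)
| tzero
| tone
| tadd (s t : term)
| tmul (s t : term).

(* Equality is primitive for numbers only, as usual in L2. *)
Inductive form : Type :=
| fbot
| feq (s t : term)
| flt (s t : term)
| fin (t : term) (X : nat)
| fimp (p q : form)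
| fall1 (p : form)
| fall2 (p : form).

Definition fneg (p : form) : form := fimp p fbot.
Definition fand (p q : form) : form := fneg (fimp p (fneg q)).
Definition for_ (p q : form) : form := fimp (fneg p) q.
Definition fiff (p q : form) : form := fand (fimp p q) (fimp q p).
Definition fex1 (p : form) : form := fneg (fall1 (fneg p)).
Definition fex2 (p : form) : form := fneg (fall2 (fneg p)).

(* Simultaneous substitution of terms for number variables and of set
   variables for set variables. *)
Definition scons {A : Type} (x : A) (f : nat -> A) (n : nat) : A :=
  match n with 0 => x | S m => f m end.

Fixpoint tsubst (f : nat -> term) (t : term) : term :=
  match t with
  | tvar n => f n
  | tzero => tzero
  | tone => tone
  | tadd s t => tadd (tsubst f s) (tsubst f t)
  | tmul s t => tmul (tsubst f s) (tsubst f t)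
  end.

Definition tlift (t : term) : term := tsubst (fun n => tvar (S n)) t.

Fixpoint subst (f : nat -> term) (g : nat -> nat) (p : form) : form :=
  match p with
  | fbot => fbot
  | feq s t => feq (tsubst f s) (tsubst f t)
  | flt s t => flt (tsubst f s) (tsubst f t)
  | fin t X => fin (tsubst f t) (g X)
  | fimp p q => fimp (subst f g p) (subst f g q)
  | fall1 p => fall1 (subst (scons (tvar 0) (fun n => tlift (f n))) g p)
  | fall2 p => fall2 (subst f (scons 0 (fun n => S (g n))) p)
  end.

Definition lift1 (p : form) : form := subst (fun n => tvar (S n)) (fun X => X) p.
Definition lift2 (p : form) : form := subst tvar S p.
Definition inst1 (t : term) (p : form) : form :=
  subst (scons t tvar) (fun X => X) p.
Definition inst2 (X : nat) (p : form) : form :=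
  subst tvar (scons X (fun Y => Y)) p.

Definition theory : Type := form -> Prop.

(* Classical natural deduction with equality.  An axiom with free variables
   stands for its universal closure, so [T] is not shifted by the
   generalization rules. *)
Inductive prv (T : theory) : list form -> form -> Prop :=
| prv_ax G p : T p -> prv T G p
| prv_hyp G p : In p G -> prv T G p
| prv_impI G p q : prv T (p :: G) q -> prv T G (fimp p q)
| prv_impE G p q : prv T G (fimp p q) -> prv T G p -> prv T G q
| prv_raa G p : prv T (fneg p :: G) fbot -> prv T G p
| prv_all1I G p : prv T (map lift1 G) p -> prv T G (fall1 p)
| prv_all1E G p t : prv T G (fall1 p) -> prv T G (inst1 t p)
| prv_all2I G p : prv T (map lift2 G) p -> prv T G (fall2 p)
| prv_all2E G p X : prv T G (fall2 p) -> prv T G (inst2 X p)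
| prv_refl G t : prv T G (feq t t)
| prv_leibniz G s t p :
    prv T G (feq s t) -> prv T G (inst1 s p) -> prv T G (inst1 t p).

Definition provable (T : theory) (p : form) : Prop := prv T [] p.

Definition theory_union (T U : theory) : theory := fun p => T p \/ U p.
Definition axiom (p : form) : theory := fun q => q = p.

Definition equivalent_over (B T U : theory) : Prop :=
  (forall p, U p -> provable (theory_union B T) p) /\
  (forall p, T p -> provable (theory_union B U) p).

Declare Scope l2_scope.
Delimit Scope l2_scope with l2.
Bind Scope l2_scope with term form.
Local Open Scope l2_scope.

Notation "# n" := (tvar n) (at level 1, n at level 0, format "# n") : l2_scope.
Notation "0" := tzero : l2_scope.
Notation "1" := tone : l2_scope.
Notation "s + t" := (tadd s t) : l2_scope.
Notation "s * t" := (tmul s t) : l2_scope.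
Notation "t ↑" := (tlift t) (at level 2, left associativity, format "t ↑") : l2_scope.
Notation "s ≐ t" := (feq s t) (at level 70, no associativity) : l2_scope.
Notation "s ≺ t" := (flt s t) (at level 70, no associativity) : l2_scope.
Notation "t ∈ X" := (fin t X) (at level 70, no associativity) : l2_scope.
Notation "¬ p" := (fneg p) (at level 75, right associativity) : l2_scope.
Notation "p ∧ q" := (fand p q) (at level 80, right associativity) : l2_scope.
Notation "p ∨ q" := (for_ p q) (at level 85, right associativity) : l2_scope.
Notation "p ⇒ q" := (fimp p q) (at level 90, right associativity) : l2_scope.
Notation "p ⇔ q" := (fiff p q) (at level 95, no associativity) : l2_scope.
Notation "∀¹ p" := (fall1 p) (at level 98, right associativity) : l2_scope.
Notation "∃¹ p" := (fex1 p) (at level 98, right associativity) : l2_scope.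
Notation "∀² p" := (fall2 p) (at level 98, right associativity) : l2_scope.
Notation "∃² p" := (fex2 p) (at level 98, right associativity) : l2_scope.

(* Closure under [fimp] yields the Boolean connectives and the bounded
   existential quantifier, as the dual of the bounded universal one. *)
Inductive Delta00 : form -> Prop :=
| D_bot : Delta00 fbot
| D_eq s t : Delta00 (s ≐ t)
| D_lt s t : Delta00 (s ≺ t)
| D_in t X : Delta00 (t ∈ X)
| D_imp p q : Delta00 p -> Delta00 q -> Delta00 (p ⇒ q)
| D_ball t p : Delta00 p -> Delta00 (∀¹ (#0 ≺ t↑ ⇒ p)).

Definition Sigma01 (p : form) : Prop := exists q, Delta00 q /\ p = fex1 q.
Definition Pi01 (p : form) : Prop := exists q, Delta00 q /\ p = fall1 q.

Fixpoint arithmetical (p : form) : Prop :=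
  match p with
  | fimp p q => arithmetical p /\ arithmetical q
  | fall1 p => arithmetical p
  | fall2 _ => False
  | _ => True
  end.

Inductive basic_axiom : theory :=
| ax_succ_nonzero : basic_axiom (∀¹ ¬ #0 + 1 ≐ 0)
| ax_succ_inj : basic_axiom (∀¹ ∀¹ (#1 + 1 ≐ #0 + 1 ⇒ #1 ≐ #0))
| ax_add_zero : basic_axiom (∀¹ #0 + 0 ≐ #0)
| ax_add_succ : basic_axiom (∀¹ ∀¹ #1 + (#0 + 1) ≐ (#1 + #0) + 1)
| ax_mul_zero : basic_axiom (∀¹ #0 * 0 ≐ 0)
| ax_mul_succ : basic_axiom (∀¹ ∀¹ #1 * (#0 + 1) ≐ #1 * #0 + #1)
| ax_lt_zero : basic_axiom (∀¹ ¬ #0 ≺ 0)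
| ax_lt_succ : basic_axiom (∀¹ ∀¹ (#1 ≺ #0 + 1 ⇔ #1 ≺ #0 ∨ #1 ≐ #0)).

(* In the schemes the distinguished variable n is number variable 0 of [p];
   all other free variables of [p] are parameters. *)
Definition at_succ (p : form) : form :=
  subst (scons (#0 + 1) (fun n => tvar (S n))) (fun X => X) p.

Definition induction (p : form) : form :=
  inst1 0 p ∧ (∀¹ (p ⇒ at_succ p)) ⇒ (∀¹ p).

(* [lift2] makes the new set variable not occur in [p]. *)
Definition comprehension (p : form) : form :=
  ∃² ∀¹ (#0 ∈ 0%nat ⇔ lift2 p).

Inductive RCA0 : theory :=
| RCA0_basic p : basic_axiom p -> RCA0 p
| RCA0_Sigma01_induction p : Sigma01 p -> RCA0 (induction p)
| RCA0_Delta01_comprehension p q :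
    Sigma01 p -> Pi01 q -> RCA0 ((∀¹ (p ⇔ q)) ⇒ comprehension p).

Inductive ACA0 : theory :=
| ACA0_basic p : basic_axiom p -> ACA0 p
| ACA0_induction : ACA0 (∀² induction (#0 ∈ 0%nat))
| ACA0_comprehension p : arithmetical p -> ACA0 (comprehension p).

(* Coding of finite objects by numbers, after Simpson's "Subsystems of
   Second Order Arithmetic", Section II.2. *)

Definition fle (s t : term) : form := s ≺ t + 1.
Definition divides (s t : term) : form := ∃¹ s↑ * #0 ≐ t↑.
Definition tpair (s t : term) : term := (s + t) * (s + t) + s.

(* A number c = (k,(m,n)) represents the finite set
   { i < k | m(i+1)+1 divides n }; its code is the least representative,
   so that finite sets and their codes correspond bijectively. *)
Definition represents (c : term) : form :=
  ∃¹ ∃¹ ∃¹ c↑↑↑ ≐ tpair #2 (tpair #1 #0).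
Definition elem (i c : term) : form :=
  ∃¹ ∃¹ ∃¹ (c↑↑↑ ≐ tpair #2 (tpair #1 #0)
            ∧ i↑↑↑ ≺ #2
            ∧ divides (#1 * (i↑↑↑ + 1) + 1) #0).
Definition finset (c : term) : form :=
  represents c
  ∧ (∀¹ (#0 ≺ c↑ ∧ represents #0 ⇒ ¬ (∀¹ (elem #0 #1 ⇔ elem #0 c↑↑)))).

(* A finite sequence is (the code of) a finite set of pairs that is a
   function with domain { j | j < l }, where l is its length. *)
Definition entry (s i x : term) : form := elem (tpair i x) s.
Definition lh (s l : term) : form :=
  ∀¹ (#0 ≺ l↑ ⇔ ∃¹ entry s↑↑ #1 #0).
Definition finseq (s : term) : form :=
  finset s
  ∧ (∀¹ (elem #0 s↑ ⇒ (∃¹ ∃¹ #2 ≐ tpair #1 #0)))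
  ∧ (∀¹ ∀¹ ∀¹ (entry s↑↑↑ #2 #1 ⇒ entry s↑↑↑ #2 #0 ⇒ #1 ≐ #0))
  ∧ (∃¹ lh s↑ #0).
Definition binseq (s : term) : form :=
  finseq s ∧ (∀¹ ∀¹ (entry s↑↑ #1 #0 ⇒ #0 ≐ 0 ∨ #0 ≐ 1)).

(* Between finite sequences, inclusion of graphs is the initial segment
   relation. *)
Definition initseg (s t : term) : form := ∀¹ (elem #0 s↑ ⇒ elem #0 t↑).
Definition imm_succ (s t : term) : form :=
  initseg s t ∧ (∃¹ (lh s↑ #0 ∧ lh t↑ (#0 + 1))).

(* |F| = k, via an injective enumeration of F of length k. *)
Definition card_eq (F k : term) : form :=
  ∃¹ (finseq #0 ∧ lh #0 k↑
      ∧ (∀¹ (elem #0 F↑↑ ⇔ ∃¹ entry #2 #0 #1))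
      ∧ (∀¹ ∀¹ ∀¹ (entry #3 #2 #0 ⇒ entry #3 #1 #0 ⇒ #2 ≐ #1))).
Definition card_le (F c : term) : form :=
  ∃¹ (card_eq F↑ #0 ∧ fle #0 c↑).

(* A total function on the numbers is a set of pairs. *)
Definition isfun (f : nat) : form :=
  (∀¹ (#0 ∈ f ⇒ (∃¹ ∃¹ #2 ≐ tpair #1 #0)))
  ∧ (∀¹ ∃¹ tpair #1 #0 ∈ f)
  ∧ (∀¹ ∀¹ ∀¹ (tpair #2 #1 ∈ f ⇒ tpair #2 #0 ∈ f ⇒ #1 ≐ #0)).

(* Below a definable collection is a map [A : term -> form] giving the formula
   "t is in A".  The maps used are [inset X] and [inrange g], which have no
   free number variable besides those of t, so no shift is needed when
   they are applied under number quantifiers. *)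
Definition inset (X : nat) (t : term) : form := t ∈ X.
Definition inrange (g : nat) (t : term) : form := ∃¹ tpair #0 t↑ ∈ g.

Definition infinite (A : term -> form) : form := ∀¹ ∃¹ (#1 ≺ #0 ∧ A #0).

Definition tree (T : term -> form) : form :=
  (∀¹ (T #0 ⇒ finseq #0))
  ∧ (∀¹ ∀¹ (T #1 ∧ finseq #0 ∧ initseg #0 #1 ⇒ T #0)).
Definition binary (T : term -> form) : form := ∀¹ (T #0 ⇒ binseq #0).
Definition finitely_branching (T : term -> form) : form :=
  ∀¹ (T #0 ⇒ (∃¹ ∀¹ (T #0 ∧ imm_succ #2 #0 ⇒ #0 ≺ #1))).
Definition extendible (T : term -> form) (s : term) : form :=
  T s ∧ (∀¹ ∃¹ ∃¹ (T #1 ∧ initseg s↑↑↑ #1 ∧ lh #1 #0 ∧ #2 ≺ #0)).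
Definition ext_level (T : term -> form) (n s : term) : form :=
  T s ∧ lh s n ∧ extendible T s.

(* In the order of the quantifiers: c, n, F and then the element of F. *)
Definition ext_bounded (T : term -> form) : form :=
  ∃¹ ∀¹ ∀¹ (finset #0 ∧ (∀¹ (elem #0 #1 ⇒ ext_level T #2 #0))
            ⇒ card_le #0 #2).

Definition path (T : term -> form) (f : nat) : form :=
  isfun f
  ∧ (∀¹ (finseq #0 ∧ (∀¹ (elem #0 #1 ⇒ #0 ∈ f)) ⇒ T #0)).

(* The outer set variable is an enumeration of the tree, i.e. a function
   whose range is the tree. *)
Definition Sigma01_WKL_ext_bd : form :=
  ∀² (isfun 0%nat
      ∧ tree (inrange 0%nat) ∧ binary (inrange 0%nat)
      ∧ infinite (inrange 0%nat) ∧ ext_bounded (inrange 0%nat)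
      ⇒ (∃² path (inrange 1%nat) 0%nat)).

Definition KL_ext_bd : form :=
  ∀² (tree (inset 0%nat) ∧ finitely_branching (inset 0%nat)
      ∧ infinite (inset 0%nat) ∧ ext_bounded (inset 0%nat)
      ⇒ (∃² path (inset 1%nat) 0%nat)).

(* Main.v *)
(* By the completeness theorem for the calculus [prv] it is enough to compare
   the models of the theories, so all the arithmetic takes place inside an
   arbitrary, possibly nonstandard, model of RCA0.

   In a model of ACA0 the set of extendible nodes of a finitely branching tree
   exists; following the extendible successor of least code from the root gives
   a path, without any bound on the number of extendible nodes.

   Conversely, arithmetical comprehension follows from the existence of the
   sets {n | exists m, (n, m) in Y}.  Such a set is computable from any path of
   a tree whose nodes s of length l satisfy, for every i < l, either s(i) = 0
   and no m < l is a witness for i, or s(i) is a certificate that i has a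
   witness: the least witness plus 1 for KL, and the number 1 for the Sigma^0_1
   tree.  An extendible node cannot take the value 0 at an i that has a
   witness, so there is at most one extendible node of each length. *)

Require Import Defs.
From Stdlib Require Import List Arith Lia Ring Cantor Classical ClassicalEpsilon.
From Stdlib Require Import FunctionalExtensionality PropExtensionality ProofIrrelevance.
Import ListNotations.

(** * Substitution in formulas and derivations *)

(** Inside a model, induction and comprehension apply only to definable predicates. The formulas are
    never written out: [definable] is a property of predicates on environments, closed under the
    logical operations, with formula and parameters hidden in an existential. In a model of RCA_0
    the working principles are Delta^0_0 comprehension and Sigma^0_1 induction, so coding notions
    have to be brought into bounded form; this succeeds because a code exceeds all elements of the
    set that it codes. The two trees differ in what a node can carry. A number can display the least
    witness, which makes membership Delta^0_0, while uniqueness of the certificate keeps the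
    branching finite. A bit gives no bound on the witness it vouches for, so the binary tree is only
    enumerated. In both trees an entry 0 may be wrong; this provides nodes of every length without
    deciding anything, and wrong nodes merely lack long extensions. Full arithmetical comprehension
    is reached by trading each number quantifier for a set parameter, until the formula is
    Delta^0_0. *)

Definition up (f : nat -> term) : nat -> term :=
  scons (tvar 0) (fun n => tlift (f n)).
Definition upset (g : nat -> nat) : nat -> nat := scons 0 (fun n => S (g n)).

Lemma tsubst_tsubst f g t :
  tsubst f (tsubst g t) = tsubst (fun n => tsubst f (g n)) t.
Proof. induction t; simpl; congruence. Qed.

Lemma tsubst_tvar t : tsubst tvar t = t.
Proof. induction t; simpl; congruence. Qed.

Lemma tsubst_up_tlift f t : tsubst (up f) (tlift t) = tlift (tsubst f t).
Proof. unfold tlift. rewrite !tsubst_tsubst. reflexivity. Qed.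

Lemma up_comp f g : (fun n => tsubst (up f) (up g n)) = up (fun n => tsubst f (g n)).
Proof.
  extensionality n. destruct n; [reflexivity|]. apply tsubst_up_tlift.
Qed.

Lemma upset_comp g1 g2 : (fun n => upset g1 (upset g2 n)) = upset (fun n => g1 (g2 n)).
Proof. extensionality n. destruct n; reflexivity. Qed.

Lemma up_tvar : up tvar = tvar.
Proof. extensionality n. destruct n; reflexivity. Qed.

Lemma upset_id : upset (fun X => X) = fun X => X.
Proof. extensionality n. destruct n; reflexivity. Qed.

Lemma subst_subst f1 g1 f2 g2 p :
  subst f1 g1 (subst f2 g2 p) =
  subst (fun n => tsubst f1 (f2 n)) (fun n => g1 (g2 n)) p.
Proof.
  revert f1 g1 f2 g2.
  induction p; intros; simpl; rewrite ?tsubst_tsubst; auto.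
  - now rewrite IHp1, IHp2.
  - f_equal. change (subst (up f1) g1 (subst (up f2) g2 p) =
      subst (up (fun n => tsubst f1 (f2 n))) (fun n => g1 (g2 n)) p).
    rewrite IHp, up_comp. reflexivity.
  - f_equal. change (subst f1 (upset g1) (subst f2 (upset g2) p) =
      subst (fun n => tsubst f1 (f2 n)) (upset (fun n => g1 (g2 n))) p).
    rewrite IHp, upset_comp. reflexivity.
Qed.

Lemma subst_id p : subst tvar (fun X => X) p = p.
Proof.
  induction p; simpl; rewrite ?tsubst_tvar; try congruence.
  - f_equal. change (subst (up tvar) (fun X => X) p = p).
    now rewrite up_tvar.
  - f_equal. change (subst tvar (upset (fun X => X)) p = p).
    now rewrite upset_id.
Qed.

Lemma tsubst_scons_tlift s f t : tsubst (scons s f) (tlift t) = tsubst f t.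
Proof. unfold tlift. rewrite tsubst_tsubst. reflexivity. Qed.

Lemma inst1_up s f g p :
  inst1 s (subst (up f) g p) = subst (scons s f) g p.
Proof.
  unfold inst1. rewrite subst_subst. f_equal.
  extensionality n. destruct n; [reflexivity|].
  unfold up; simpl. rewrite tsubst_scons_tlift. apply tsubst_tvar.
Qed.

Lemma inst2_up X f g p :
  inst2 X (subst f (upset g) p) = subst f (scons X g) p.
Proof.
  unfold inst2. rewrite subst_subst. f_equal.
  - extensionality n. apply tsubst_tvar.
  - extensionality n. destruct n; reflexivity.
Qed.

Lemma subst_inst1 f g t p :
  subst f g (inst1 t p) = inst1 (tsubst f t) (subst (up f) g p).
Proof.
  rewrite inst1_up. unfold inst1. rewrite subst_subst. f_equal.
  extensionality n. destruct n; reflexivity.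
Qed.

Lemma subst_inst2 f g X p :
  subst f g (inst2 X p) = inst2 (g X) (subst f (upset g) p).
Proof.
  rewrite inst2_up. unfold inst2. rewrite subst_subst. f_equal.
  extensionality n. destruct n; reflexivity.
Qed.

Lemma lift1_subst f g p : lift1 (subst f g p) = subst (up f) g (lift1 p).
Proof. unfold lift1. rewrite !subst_subst. reflexivity. Qed.

Lemma lift2_subst f g p : lift2 (subst f g p) = subst f (upset g) (lift2 p).
Proof.
  unfold lift2. rewrite !subst_subst. f_equal.
  extensionality n. simpl. now rewrite tsubst_tvar.
Qed.

(* Strict upper bounds on the free variables of each sort. *)
Fixpoint tbound (t : term) : nat :=
  match t with
  | tvar n => S n
  | tadd s t | tmul s t => max (tbound s) (tbound t)
  | _ => 0
  end.

Fixpoint bound1 (p : form) : nat :=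
  match p with
  | fbot => 0
  | feq s t | flt s t => max (tbound s) (tbound t)
  | fin t _ => tbound t
  | fimp p q => max (bound1 p) (bound1 q)
  | fall1 p => pred (bound1 p)
  | fall2 p => bound1 p
  end.

Fixpoint bound2 (p : form) : nat :=
  match p with
  | fin _ X => S X
  | fimp p q => max (bound2 p) (bound2 q)
  | fall1 p => bound2 p
  | fall2 p => pred (bound2 p)
  | _ => 0
  end.

Lemma tsubst_bound f f' t :
  (forall n, n < tbound t -> f n = f' n) -> tsubst f t = tsubst f' t.
Proof.
  induction t; simpl; intros H; auto; f_equal;
    (apply IHt1 || apply IHt2); intros; apply H; lia.
Qed.

Lemma subst_bound f f' g g' p :
  (forall n, n < bound1 p -> f n = f' n) ->
  (forall n, n < bound2 p -> g n = g' n) ->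
  subst f g p = subst f' g' p.
Proof.
  revert f f' g g'. induction p; simpl; intros f f' g g' H1 H2; auto.
  - f_equal; apply tsubst_bound; intros; apply H1; lia.
  - f_equal; apply tsubst_bound; intros; apply H1; lia.
  - f_equal; [apply tsubst_bound; intros; apply H1; lia | apply H2; lia].
  - f_equal; [apply IHp1|apply IHp2]; intros; (apply H1 || apply H2); lia.
  - f_equal. apply IHp; auto. intros [|n] Hn; [reflexivity|].
    simpl. now rewrite H1 by lia.
  - f_equal. apply IHp; auto. intros [|n] Hn; [reflexivity|].
    simpl. now rewrite H2 by lia.
Qed.

(** * Weakening, substitution and generalization in derivations *)

Lemma prv_weaken T G G' p : prv T G p -> incl G G' -> prv T G' p.
Proof.
  intros H. revert G'. induction H; intros G' HG.
  - now apply prv_ax.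
  - apply prv_hyp; auto.
  - apply prv_impI, IHprv. intros x [<-|Hx]; [now left | right; auto].
  - eapply prv_impE; eauto.
  - apply prv_raa, IHprv. intros x [<-|Hx]; [now left | right; auto].
  - apply prv_all1I, IHprv, incl_map, HG.
  - apply prv_all1E; auto.
  - apply prv_all2I, IHprv, incl_map, HG.
  - apply prv_all2E; auto.
  - apply prv_refl.
  - eapply prv_leibniz; eauto.
Qed.

Fixpoint iter_all1 n p := match n with 0 => p | S n => iter_all1 n (fall1 p) end.
Fixpoint iter_all2 n p := match n with 0 => p | S n => iter_all2 n (fall2 p) end.

Lemma bound1_iter_all1 n p : bound1 (iter_all1 n p) = bound1 p - n.
Proof. revert p. induction n; simpl; intros; [lia|]. rewrite IHn. simpl. lia. Qed.
Lemma bound2_iter_all1 n p : bound2 (iter_all1 n p) = bound2 p.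
Proof. revert p. induction n; simpl; intros; [lia|]. now rewrite IHn. Qed.
Lemma bound2_iter_all2 n p : bound2 (iter_all2 n p) = bound2 p - n.
Proof. revert p. induction n; simpl; intros; [lia|]. rewrite IHn. simpl. lia. Qed.
Lemma bound1_iter_all2 n p : bound1 (iter_all2 n p) = bound1 p.
Proof. revert p. induction n; simpl; intros; [lia|]. now rewrite IHn. Qed.

Lemma prv_iter_all1 T n p : prv T [] p -> prv T [] (iter_all1 n p).
Proof.
  revert p. induction n; simpl; intros; auto. apply IHn, prv_all1I; auto.
Qed.
Lemma prv_iter_all2 T n p : prv T [] p -> prv T [] (iter_all2 n p).
Proof.
  revert p. induction n; simpl; intros; auto. apply IHn, prv_all2I; auto.
Qed.

Lemma scons_eta {A} (f : nat -> A) : scons (f 0) (fun n => f (S n)) = f.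
Proof. extensionality n. destruct n; reflexivity. Qed.

Lemma prv_iter_all1_elim T n p f g :
  prv T [] (subst (fun k => f (n + k)) g (iter_all1 n p)) ->
  prv T [] (subst f g p).
Proof.
  revert p f. induction n; intros p f H.
  - exact H.
  - simpl in H. specialize (IHn (fall1 p) (fun n => f (S n)) H).
    apply (prv_all1E T [] (subst (up (fun n => f (S n))) g p) (f 0)) in IHn.
    rewrite inst1_up, scons_eta in IHn. exact IHn.
Qed.

Lemma prv_iter_all2_elim T n p f g :
  prv T [] (subst f (fun k => g (n + k)) (iter_all2 n p)) ->
  prv T [] (subst f g p).
Proof.
  revert p g. induction n; intros p g H.
  - exact H.
  - simpl in H. specialize (IHn (fall2 p) (fun n => g (S n)) H).
    apply (prv_all2E T [] (subst f (upset (fun n => g (S n))) p) (g 0)) in IHn.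
    rewrite inst2_up, scons_eta in IHn. exact IHn.
Qed.

(* The universal closure of a theorem is a closed theorem, so substitution
   instances follow by instantiating it. *)
Lemma prv_subst_closed T p f g : prv T [] p -> prv T [] (subst f g p).
Proof.
  intros H. apply (prv_iter_all1_elim T (bound1 p)).
  apply (prv_iter_all2_elim T (bound2 p)).
  erewrite (subst_bound _ tvar _ (fun X => X)), subst_id.
  - apply prv_iter_all2, prv_iter_all1, H.
  - rewrite bound1_iter_all2, bound1_iter_all1. intros; lia.
  - rewrite bound2_iter_all2, bound2_iter_all1. intros; lia.
Qed.

Lemma prv_subst T G p f g :
  prv T G p -> prv T (map (subst f g) G) (subst f g p).
Proof.
  intros H. revert f g. induction H; intros f g.
  - apply prv_weaken with []; [|easy]. apply prv_subst_closed, prv_ax, H.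
  - apply prv_hyp, in_map, H.
  - apply prv_impI, IHprv.
  - eapply prv_impE; [apply IHprv1 | apply IHprv2].
  - apply prv_raa, IHprv.
  - apply prv_all1I. specialize (IHprv (up f) g).
    rewrite map_map in *. erewrite map_ext; [apply IHprv|].
    intros; apply lift1_subst.
  - rewrite subst_inst1. apply prv_all1E, IHprv.
  - apply prv_all2I. specialize (IHprv f (upset g)).
    rewrite map_map in *. erewrite map_ext; [apply IHprv|].
    intros; apply lift2_subst.
  - rewrite subst_inst2. apply (prv_all2E _ _ _ (g X)), IHprv.
  - apply prv_refl.
  - rewrite subst_inst1. eapply prv_leibniz; [apply IHprv1|].
    rewrite <- subst_inst1. apply IHprv2.
Qed.

(** The substitution sends variable [x] to 0 and shifts all others. Since [x] is beyond the free
    variables of [G], it acts on [G] as [lift1], and it turns the instance at [x] back into [p]; the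
    result is the premise of [prv_all1I]. *)
Lemma prv_all1_fresh T G p x :
  Forall (fun q => bound1 q <= x) G -> bound1 (fall1 p) <= x ->
  prv T G (inst1 (tvar x) p) -> prv T G (fall1 p).
Proof.
  intros HG Hp H. apply prv_all1I.
  apply (prv_subst _ _ _ (fun n => if n =? x then tvar 0 else tvar (S n)) (fun X => X)) in H.
  assert (Hmap : map (subst (fun n => if n =? x then tvar 0 else tvar (S n)) (fun X => X)) G
                 = map lift1 G).
  { apply map_ext_in. intros q Hq. rewrite Forall_forall in HG. apply HG in Hq.
    apply subst_bound; auto. intros n Hn.
    destruct (Nat.eqb_spec n x); [lia|reflexivity]. }
  rewrite Hmap in H. unfold inst1 in H. rewrite subst_subst in H.
  erewrite (subst_bound _ tvar _ (fun X => X)), subst_id in H; auto.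
  intros [|n] Hn; simpl.
  - now rewrite Nat.eqb_refl.
  - simpl in Hp. destruct (Nat.eqb_spec n x); [lia|reflexivity].
Qed.

Lemma prv_all2_fresh T G p x :
  Forall (fun q => bound2 q <= x) G -> bound2 (fall2 p) <= x ->
  prv T G (inst2 x p) -> prv T G (fall2 p).
Proof.
  intros HG Hp H. apply prv_all2I.
  apply (prv_subst _ _ _ tvar (fun n => if n =? x then 0 else S n)) in H.
  assert (Hmap : map (subst tvar (fun n => if n =? x then 0 else S n)) G
                 = map lift2 G).
  { apply map_ext_in. intros q Hq. rewrite Forall_forall in HG. apply HG in Hq.
    apply subst_bound; auto. intros n Hn.
    destruct (Nat.eqb_spec n x); [lia|reflexivity]. }
  rewrite Hmap in H. unfold inst2 in H. rewrite subst_subst in H.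
  erewrite (subst_bound _ tvar _ (fun X => X)), subst_id in H; auto.
  intros [|n] Hn; simpl.
  - now rewrite Nat.eqb_refl.
  - simpl in Hp. destruct (Nat.eqb_spec n x); [lia|reflexivity].
Qed.

Local Notation pr a b := (Cantor.to_nat (a, b)).

(** Tags and Cantor pairing number the syntax injectively; the Henkin construction relies on this to
    treat every formula at some stage. *)
Fixpoint tcode (t : term) : nat :=
  match t with
  | tvar n => pr 0 n
  | tzero => pr 1 0
  | tone => pr 2 0
  | tadd s t => pr 3 (pr (tcode s) (tcode t))
  | tmul s t => pr 4 (pr (tcode s) (tcode t))
  end.

Fixpoint fcode (p : form) : nat :=
  match p with
  | fbot => pr 0 0
  | feq s t => pr 1 (pr (tcode s) (tcode t))
  | flt s t => pr 2 (pr (tcode s) (tcode t))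
  | fin t X => pr 3 (pr (tcode t) X)
  | fimp p q => pr 4 (pr (fcode p) (fcode q))
  | fall1 p => pr 5 (fcode p)
  | fall2 p => pr 6 (fcode p)
  end.

Ltac inj_codes :=
  repeat match goal with
  | H : pr _ _ = pr _ _ |- _ => apply to_nat_inj, pair_equal_spec in H; destruct H; try discriminate
  end.

Lemma tcode_inj s t : tcode s = tcode t -> s = t.
Proof.
  revert t. induction s; intros t'; destruct t'; cbn [tcode]; intros H; inj_codes;
    try congruence; f_equal; auto.
Qed.

Lemma fcode_inj p q : fcode p = fcode q -> p = q.
Proof.
  revert q. induction p; intros q; destruct q; cbn [fcode]; intros H; inj_codes;
    try congruence; f_equal; auto using tcode_inj.
Qed.

Definition fdecode (n : nat) : form := epsilon (inhabits fbot) (fun p => fcode p = n).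

Lemma fdecode_fcode p : fdecode (fcode p) = p.
Proof.
  apply fcode_inj. unfold fdecode. apply epsilon_spec. now exists p.
Qed.

(** * Completeness *)

(* Satisfaction refers to an environment of sets even for formulas without set
   variables; [some_set] provides one. *)
Record structure := {
  num : Type;
  sets : Type;
  zero : num;
  one : num;
  add : num -> num -> num;
  mul : num -> num -> num;
  lt : num -> num -> Prop;
  mem : num -> sets -> Prop;
  some_set : sets
}.
Arguments zero {_}.
Arguments one {_}.
Arguments add {_}.
Arguments mul {_}.
Arguments lt {_}.
Arguments mem {_}.
Arguments some_set {_}.

Fixpoint teval {M : structure} (v : nat -> num M) (t : term) : num M :=
  match t with
  | tvar n => v n
  | tzero => zero
  | tone => one
  | tadd s t => add (teval v s) (teval v t)
  | tmul s t => mul (teval v s) (teval v t)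
  end.

Fixpoint sat {M : structure} (v : nat -> num M) (X : nat -> sets M) (p : form) : Prop :=
  match p with
  | fbot => False
  | feq s t => teval v s = teval v t
  | flt s t => lt (teval v s) (teval v t)
  | fin t Y => mem (teval v t) (X Y)
  | fimp p q => sat v X p -> sat v X q
  | fall1 p => forall a, sat (scons a v) X p
  | fall2 p => forall Y, sat v (scons Y X) p
  end.

Definition valid (M : structure) (p : form) : Prop := forall v X, @sat M v X p.
Definition model (T : theory) (M : structure) : Prop := forall p, T p -> valid M p.

Section Henkin.
Variables (T : theory) (G0 : list form).
Hypothesis G0_consistent : ~ prv T G0 fbot.

Definition max_bound (b : form -> nat) (G : list form) : nat :=
  fold_right (fun p n => max (b p) n) 0 G.

Lemma max_bound_spec b G : Forall (fun q => b q <= max_bound b G) G.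
Proof.
  induction G as [|p G IH]; simpl; constructor; [lia|].
  eapply Forall_impl; [|exact IH]. simpl; intros; lia.
Qed.

(** A refuted universal formula receives a counterexample. The chosen variable is beyond the free
    variables of the formula and of the context, hence fresh. *)
Definition witness (p : form) (G : list form) : list form :=
  match p with
  | fall1 q => [fneg (inst1 (tvar (max_bound bound1 (p :: G))) q)]
  | fall2 q => [fneg (inst2 (max_bound bound2 (p :: G)) q)]
  | _ => []
  end.

Definition henkin_step (p : form) (G : list form) : list form :=
  if excluded_middle_informative (prv T (p :: G) fbot)
  then witness p G ++ fneg p :: G
  else p :: G.

Fixpoint stage (n : nat) : list form :=
  match n with 0 => G0 | S n => henkin_step (fdecode n) (stage n) end.

Lemma fresh_bound b p G :
  b (fneg p) <= b p -> Forall (fun q => b q <= max_bound b (p :: G)) (fneg p :: G).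
Proof.
  intros Hb. pose proof (max_bound_spec b (p :: G)) as HG.
  inversion_clear HG. constructor; [lia|assumption].
Qed.

(** Adding [fneg p] is safe when [p] contradicts the context. If the counterexample for a universal
    [p] did harm, [prv_raa] would prove the instance at a fresh variable, and generalization would
    prove [p] itself. *)
Lemma henkin_step_consistent p G :
  ~ prv T G fbot -> ~ prv T (henkin_step p G) fbot.
Proof.
  intros HG. unfold henkin_step.
  destruct (excluded_middle_informative _) as [Hp|Hp]; [|exact Hp].
  assert (Hn : prv T (fneg p :: G) fbot -> False).
  { intros H. apply HG. apply prv_impE with p; [apply prv_impI, Hp|].
    apply prv_raa, H. }
  intros H. apply Hn.
  destruct p; try exact H.
  - apply prv_impE with (fall1 p); [apply prv_hyp; now left|].
    eapply prv_all1_fresh with (x := max_bound bound1 (fall1 p :: G)).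
    + apply fresh_bound. simpl; lia.
    + pose proof (max_bound_spec bound1 (fall1 p :: G)) as HB.
      now inversion_clear HB.
    + apply prv_raa, H.
  - apply prv_impE with (fall2 p); [apply prv_hyp; now left|].
    eapply prv_all2_fresh with (x := max_bound bound2 (fall2 p :: G)).
    + apply fresh_bound. simpl; lia.
    + pose proof (max_bound_spec bound2 (fall2 p :: G)) as HB.
      now inversion_clear HB.
    + apply prv_raa, H.
Qed.

Lemma stage_consistent n : ~ prv T (stage n) fbot.
Proof. induction n; simpl; auto using henkin_step_consistent. Qed.

Lemma stage_incl n m : n <= m -> incl (stage n) (stage m).
Proof.
  induction 1 as [|m _ IH]; [apply incl_refl|].
  apply incl_tran with (stage m); auto. simpl. unfold henkin_step.
  destruct (excluded_middle_informative _).
  - apply incl_appr, incl_tl, incl_refl.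
  - apply incl_tl, incl_refl.
Qed.

(** Provability from some stage, rather than membership in one, makes the completed theory
    deductively closed from the start. *)
Definition henkin (p : form) : Prop := exists n, prv T (stage n) p.

Lemma henkin_prv (L : list form) p : Forall henkin L -> prv T L p -> henkin p.
Proof.
  intros HL Hp.
  assert (H : exists n, Forall (fun q => prv T (stage n) q) L).
  { clear Hp. induction HL as [|q L [n Hn] HL [m Hm]].
    - exists 0; auto.
    - exists (max n m). constructor.
      + apply prv_weaken with (stage n); auto. apply stage_incl. lia.
      + eapply Forall_impl; [|exact Hm]. intros r Hr.
        apply prv_weaken with (stage m); auto. apply stage_incl. lia. }
  destruct H as [n Hn]. exists n.
  assert (H : prv T (L ++ stage n) p).
  { apply prv_weaken with L; auto. apply incl_appl, incl_refl. }
  clear HL Hp. induction L as [|q L IH]; simpl in *; auto.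
  inversion_clear Hn. apply IH; auto.
  apply prv_impE with q; [apply prv_impI, H|].
  apply prv_weaken with (stage n); auto. apply incl_appr, incl_refl.
Qed.

Lemma henkin_bot : ~ henkin fbot.
Proof. intros [n Hn]. exact (stage_consistent n Hn). Qed.

Lemma henkin_in n p : In p (stage n) -> henkin p.
Proof. intros H. exists n. now apply prv_hyp. Qed.

Lemma stage_fcode p : stage (S (fcode p)) = henkin_step p (stage (fcode p)).
Proof. cbn [stage]. now rewrite fdecode_fcode. Qed.

Lemma henkin_total p : henkin p \/ henkin (fneg p).
Proof.
  pose proof (stage_fcode p) as H.
  unfold henkin_step in H. destruct (excluded_middle_informative _).
  - right. apply henkin_in with (S (fcode p)). rewrite H.
    apply in_or_app. right; now left.
  - left. apply henkin_in with (S (fcode p)). rewrite H. now left.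
Qed.

Lemma henkin_imp p q : henkin (fimp p q) <-> (henkin p -> henkin q).
Proof.
  split.
  - intros H Hp. apply (henkin_prv [fimp p q; p]); [repeat constructor; auto|].
    apply prv_impE with p; apply prv_hyp; simpl; auto.
  - intros H. destruct (henkin_total p) as [Hp|Hp].
    + apply (henkin_prv [q]); [auto|]. apply prv_impI, prv_hyp. simpl; auto.
    + apply (henkin_prv [fneg p]); [auto|]. apply prv_impI, prv_raa.
      apply prv_impE with p; apply prv_hyp; simpl; auto.
Qed.

Lemma henkin_neg p : henkin (fneg p) <-> ~ henkin p.
Proof.
  unfold fneg. rewrite henkin_imp. pose proof henkin_bot. tauto.
Qed.

Lemma henkin_all1 p : henkin (fall1 p) <-> forall t, henkin (inst1 t p).
Proof.
  split.
  - intros H t. apply (henkin_prv [fall1 p]); [auto|].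
    apply prv_all1E, prv_hyp. now left.
  - intros H. set (q := fall1 p).
    pose proof (stage_fcode q) as E.
    unfold henkin_step in E. destruct (excluded_middle_informative _).
    (* The stage that rejected [q] also added the negation of one instance, against [H]. *)
    + exfalso. refine (proj1 (henkin_neg _) _ (H (tvar (max_bound bound1 (q :: stage (fcode q)))))).
      apply henkin_in with (S (fcode q)). rewrite E. now left.
    + apply henkin_in with (S (fcode q)). rewrite E. now left.
Qed.

Lemma henkin_all2 p : henkin (fall2 p) <-> forall X, henkin (inst2 X p).
Proof.
  split.
  - intros H t. apply (henkin_prv [fall2 p]); [auto|].
    apply prv_all2E, prv_hyp. now left.
  - intros H. set (q := fall2 p).
    pose proof (stage_fcode q) as E.
    unfold henkin_step in E. destruct (excluded_middle_informative _).
    + exfalso. refine (proj1 (henkin_neg _) _ (H (max_bound bound2 (q :: stage (fcode q))))).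
      apply henkin_in with (S (fcode q)). rewrite E. now left.
    + apply henkin_in with (S (fcode q)). rewrite E. now left.
Qed.

Definition teq (s t : term) : Prop := henkin (feq s t).

Lemma teq_refl t : teq t t.
Proof. exists 0. apply prv_refl. Qed.

Lemma henkin_leibniz s t p : teq s t -> henkin (inst1 s p) -> henkin (inst1 t p).
Proof.
  intros H1 H2. apply (henkin_prv [feq s t; inst1 s p]); [auto|].
  apply prv_leibniz with s; apply prv_hyp; simpl; auto.
Qed.

Lemma tsubst_inst_tlift s t : tsubst (scons s tvar) (tlift t) = t.
Proof. rewrite tsubst_scons_tlift. apply tsubst_tvar. Qed.

Lemma teq_sym s t : teq s t -> teq t s.
Proof.
  intros H. pose proof (henkin_leibniz s t (feq (tvar 0) (tlift s)) H) as H1.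
  unfold inst1 in H1. simpl in H1. rewrite !tsubst_inst_tlift in H1.
  apply H1, teq_refl.
Qed.

Lemma teq_trans s t u : teq s t -> teq t u -> teq s u.
Proof.
  intros H H'. pose proof (henkin_leibniz t u (feq (tlift s) (tvar 0)) H') as H1.
  unfold inst1 in H1. simpl in H1. rewrite !tsubst_inst_tlift in H1.
  apply H1, H.
Qed.

(** Leibniz changes one argument at a time: that argument is [tvar 0], and the others are lifted so
    that the instantiation leaves them alone. *)
Lemma teq_op (op : term -> term -> term) s s' t t' :
  (forall f a b, tsubst f (op a b) = op (tsubst f a) (tsubst f b)) ->
  teq s s' -> teq t t' -> teq (op s t) (op s' t').
Proof.
  intros Hop Hs Ht. apply teq_trans with (op s' t).
  - pose proof (henkin_leibniz s s' (feq (op (tlift s) (tlift t)) (op (tvar 0) (tlift t))) Hs) as H.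
    unfold inst1 in H. simpl in H. rewrite !Hop, !tsubst_inst_tlift in H.
    apply H, teq_refl.
  - pose proof (henkin_leibniz t t'
      (feq (op (tlift s') (tlift t)) (op (tlift s') (tvar 0))) Ht) as H.
    unfold inst1 in H. simpl in H. rewrite !Hop, !tsubst_inst_tlift in H.
    apply H, teq_refl.
Qed.

Lemma henkin_lt s s' t t' : teq s s' -> teq t t' -> henkin (flt s t) -> henkin (flt s' t').
Proof.
  intros Hs Ht H.
  pose proof (henkin_leibniz s s' (flt (tvar 0) (tlift t)) Hs) as H1.
  unfold inst1 in H1. simpl in H1. rewrite !tsubst_inst_tlift in H1.
  pose proof (henkin_leibniz t t' (flt (tlift s') (tvar 0)) Ht) as H2.
  unfold inst1 in H2. simpl in H2. rewrite !tsubst_inst_tlift in H2. auto.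
Qed.

Lemma henkin_mem s t X : teq s t -> henkin (fin s X) -> henkin (fin t X).
Proof.
  intros Hs. pose proof (henkin_leibniz s t (fin (tvar 0) X) Hs) as H1.
  exact H1.
Qed.

(** One chosen representative per [teq]-class realizes the quotient as a subset type of terms.
    Equivalent terms get the same one because [epsilon] is then applied to equal predicates. *)
Definition canon (t : term) : term := epsilon (inhabits tzero) (teq t).

Lemma canon_teq t : teq t (canon t).
Proof. unfold canon. apply epsilon_spec. exists t. apply teq_refl. Qed.

Lemma teq_canon s t : teq s t -> canon s = canon t.
Proof.
  intros H. unfold canon. f_equal. extensionality u.
  apply propositional_extensionality. split; intros H'.
  - apply teq_trans with s; auto using teq_sym.
  - apply teq_trans with t; auto.
Qed.

Definition class : Type := {t | canon t = t}.
Definition cls (t : term) : class :=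
  exist _ (canon t) (eq_sym (teq_canon _ _ (canon_teq t))).
Definition repr (a : class) : term := proj1_sig a.

Lemma cls_repr a : cls (repr a) = a.
Proof. destruct a as [t Ht]. apply subset_eq_compat. exact Ht. Qed.

Lemma cls_eq s t : cls s = cls t <-> teq s t.
Proof.
  split.
  - intros H. apply (f_equal repr) in H. simpl in H.
    apply teq_trans with (canon s); [apply canon_teq|].
    rewrite H. apply teq_sym, canon_teq.
  - intros H. apply subset_eq_compat, teq_canon, H.
Qed.

Lemma repr_cls t : teq (repr (cls t)) t.
Proof. apply teq_sym, canon_teq. Qed.

(** Set variables serve directly as sets: the language has no equality between sets that would force
    identifications. *)
Definition term_model : structure := {|
  num := class;
  sets := nat;
  zero := cls tzero;
  one := cls tone;
  add a b := cls (tadd (repr a) (repr b));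
  mul a b := cls (tmul (repr a) (repr b));
  lt a b := henkin (flt (repr a) (repr b));
  mem a X := henkin (fin (repr a) X);
  some_set := 0
|}.

Lemma teval_term_model f t :
  @teval term_model (fun n => cls (f n)) t = cls (tsubst f t).
Proof.
  induction t; simpl; auto; rewrite IHt1, IHt2; apply cls_eq;
    (apply (teq_op tadd) || apply (teq_op tmul)); auto using repr_cls.
Qed.

(** The truth lemma is stated for all substitutions instead of the identity, so that in the
    quantifier cases the new element extends the substitution. *)
Lemma sat_term_model p f g :
  @sat term_model (fun n => cls (f n)) g p <-> henkin (subst f g p).
Proof.
  revert f g. induction p; intros f g; simpl.
  - split; [easy | apply henkin_bot].
  - rewrite !teval_term_model. apply cls_eq.
  - rewrite !teval_term_model.
    split; apply henkin_lt; auto using repr_cls, teq_sym.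
  - rewrite teval_term_model.
    split; apply henkin_mem; auto using repr_cls, teq_sym.
  - rewrite henkin_imp, IHp1, IHp2. reflexivity.
  - rewrite henkin_all1. split; intros H a.
    + change (henkin (inst1 a (subst (up f) g p))).
      rewrite inst1_up, <- IHp.
      replace (fun n => cls (scons a f n)) with (scons (cls a) (fun n => cls (f n)));
        [apply H|].
      extensionality n. destruct n; reflexivity.
    + specialize (H (repr a)). change (henkin (inst1 (repr a) (subst (up f) g p))) in H.
      rewrite inst1_up, <- IHp in H.
      replace (fun n => cls (scons (repr a) f n)) with (scons a (fun n => cls (f n))) in H;
        [apply H|].
      extensionality n. destruct n; [symmetry; apply cls_repr | reflexivity].
  - rewrite henkin_all2. split; intros H X; specialize (H X).
    + change (henkin (inst2 X (subst f (upset g) p))).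
      rewrite inst2_up, <- IHp. exact H.
    + change (henkin (inst2 X (subst f (upset g) p))) in H.
      rewrite inst2_up, <- IHp in H. exact H.
Qed.

Lemma term_model_model : model T term_model.
Proof.
  intros p Hp v X.
  (* Every valuation comes from a substitution, and substitution instances of an axiom are provable;
     hence axioms hold in the sense of their universal closures. *)
  replace v with (fun n => cls (repr (v n))) by (extensionality n; apply cls_repr).
  apply sat_term_model. exists 0. apply prv_weaken with []; [|easy].
  apply prv_subst_closed, prv_ax, Hp.
Qed.

Lemma term_model_context p : In p G0 -> @sat term_model (fun n => cls (tvar n)) (fun X => X) p.
Proof.
  intros Hp. apply sat_term_model. rewrite subst_id. now apply (henkin_in 0).
Qed.

End Henkin.

Theorem completeness T p : (forall M, model T M -> valid M p) -> provable T p.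
Proof.
  intros H. apply NNPP. intros Hp.
  assert (HG : ~ prv T [fneg p] fbot) by (intros H0; apply Hp, prv_raa, H0).
  refine (term_model_context T [fneg p] HG (fneg p) _ _); [now left|].
  apply H, term_model_model, HG.
Qed.

(** * Semantics and definability *)

Lemma forall_iff {A} (P Q : A -> Prop) :
  (forall a, P a <-> Q a) -> ((forall a, P a) <-> forall a, Q a).
Proof. firstorder. Qed.

Lemma exists_iff {A} (P Q : A -> Prop) :
  (forall a, P a <-> Q a) -> ((exists a, P a) <-> exists a, Q a).
Proof. firstorder. Qed.

Section Semantics.
Context {M : structure}.
Implicit Types (v : nat -> num M) (X : nat -> sets M) (p q : form).

Lemma teval_tsubst v f t : teval v (tsubst f t) = teval (fun n => teval v (f n)) t.
Proof. induction t; simpl; congruence. Qed.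

Lemma teval_tlift a v t : teval (scons a v) (tlift t) = teval v t.
Proof. unfold tlift. now rewrite teval_tsubst. Qed.

Lemma sat_subst v X f g p :
  sat v X (subst f g p) <-> sat (fun n => teval v (f n)) (fun n => X (g n)) p.
Proof.
  revert v X f g. induction p; intros; simpl; rewrite ?teval_tsubst; try tauto.
  - now rewrite IHp1, IHp2.
  - apply forall_iff. intros a. rewrite IHp.
    replace (fun n => teval (scons a v) (scons (tvar 0) (fun m => tlift (f m)) n))
      with (scons a (fun n => teval v (f n))); [tauto|].
    extensionality n. destruct n; simpl; auto. now rewrite teval_tlift.
  - apply forall_iff. intros Y. rewrite IHp.
    replace (fun n => scons Y X (scons 0 (fun m => S (g m)) n))
      with (scons Y (fun n => X (g n))); [tauto|].
    extensionality n. destruct n; reflexivity.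
Qed.

Lemma sat_inst1 v X t p : sat v X (inst1 t p) <-> sat (scons (teval v t) v) X p.
Proof.
  unfold inst1. rewrite sat_subst.
  replace (fun n => teval v (scons t tvar n)) with (scons (teval v t) v); [tauto|].
  extensionality n. destruct n; reflexivity.
Qed.

Lemma sat_lift2 v Y X p : sat v (scons Y X) (lift2 p) <-> sat v X p.
Proof. unfold lift2. rewrite sat_subst. reflexivity. Qed.

Lemma sat_fneg v X p : sat v X (fneg p) <-> ~ sat v X p.
Proof. reflexivity. Qed.
Lemma sat_fand v X p q : sat v X (fand p q) <-> sat v X p /\ sat v X q.
Proof. unfold fand, fneg. simpl. tauto. Qed.
Lemma sat_for v X p q : sat v X (for_ p q) <-> sat v X p \/ sat v X q.
Proof. unfold for_, fneg. simpl. tauto. Qed.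
Lemma sat_fiff v X p q : sat v X (fiff p q) <-> (sat v X p <-> sat v X q).
Proof. unfold fiff. rewrite sat_fand. simpl. tauto. Qed.
Lemma sat_fex1 v X p : sat v X (fex1 p) <-> exists a, sat (scons a v) X p.
Proof.
  unfold fex1, fneg. simpl. split.
  - intros H. apply NNPP. intros H'. apply H. intros a Ha. apply H'. now exists a.
  - intros [a Ha] H. exact (H a Ha).
Qed.
Lemma sat_fex2 v X p : sat v X (fex2 p) <-> exists Y, sat v (scons Y X) p.
Proof.
  unfold fex2, fneg. simpl. split.
  - intros H. apply NNPP. intros H'. apply H. intros a Ha. apply H'. now exists a.
  - intros [a Ha] H. exact (H a Ha).
Qed.

End Semantics.

(* A formula defining a predicate of [e] with parameters reads [e] on the even
   variables and the parameters on the odd ones. *)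
Fixpoint mix {A} (e v : nat -> A) (n : nat) : A :=
  match n with
  | 0 => e 0
  | 1 => v 0
  | S (S n) => mix (fun i => e (S i)) (fun i => v (S i)) n
  end.

Lemma mix_even {A} (e v : nat -> A) i : mix e v (i + i) = e i.
Proof.
  revert e v. induction i; intros; [reflexivity|].
  rewrite Nat.add_succ_r. simpl. apply (IHi (fun i => e (S i))).
Qed.

Lemma mix_odd {A} (e v : nat -> A) i : mix e v (S (i + i)) = v i.
Proof.
  revert e v. induction i; intros; [reflexivity|].
  rewrite Nat.add_succ_r. simpl. apply (IHi (fun i => e (S i)) (fun i => v (S i))).
Qed.

Lemma even_odd_cases n : exists i, n = i + i \/ n = S (i + i).
Proof. destruct (Nat.Even_or_Odd n) as [[i ->]|[i ->]]; exists i; lia. Qed.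

Lemma even_double i : Nat.even (i + i) = true.
Proof. apply Nat.even_spec. exists i. lia. Qed.
Lemma even_double_succ i : Nat.even (S (i + i)) = false.
Proof. rewrite Nat.even_succ, <- Nat.negb_even, even_double. reflexivity. Qed.

(* [mix_left], [mix_right]: parameters [v], [w] inside the common list [mix v w];
   [mix_bind]: a bound variable becomes the first variable of [scons a e]. *)
Definition mix_left (n : nat) : nat := if Nat.even n then n else 2 * n - 1.
Definition mix_right (n : nat) : nat := if Nat.even n then n else 2 * n + 1.
Definition mix_bind (n : nat) : nat :=
  match n with 0 => 0 | S m => if Nat.even n then m else S n end.

Lemma mix_mix_left {A} (e v w : nat -> A) n : mix e (mix v w) (mix_left n) = mix e v n.
Proof.
  unfold mix_left. destruct (even_odd_cases n) as [i [-> | ->]].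
  - now rewrite even_double, !mix_even.
  - rewrite even_double_succ.
    replace (2 * S (i + i) - 1) with (S ((i + i) + (i + i))) by lia.
    now rewrite !mix_odd, mix_even.
Qed.

Lemma mix_mix_right {A} (e v w : nat -> A) n : mix e (mix v w) (mix_right n) = mix e w n.
Proof.
  unfold mix_right. destruct (even_odd_cases n) as [i [-> | ->]].
  - now rewrite even_double, !mix_even.
  - rewrite even_double_succ.
    replace (2 * S (i + i) + 1) with (S (S (i + i) + S (i + i))) by lia.
    now rewrite !mix_odd.
Qed.

Lemma mix_mix_bind {A} (a : A) e v n :
  scons a (mix e v) (mix_bind n) = mix (scons a e) v n.
Proof.
  unfold mix_bind. destruct (even_odd_cases n) as [i [-> | ->]].
  - destruct i; [reflexivity|]. rewrite Nat.add_succ_r. simpl Nat.add.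
    cbn iota. rewrite <- Nat.add_succ_r, <- Nat.add_succ_l, even_double.
    rewrite mix_even. simpl. rewrite Nat.add_succ_r. simpl. apply mix_even.
  - rewrite even_double_succ, mix_odd. cbn [scons]. apply mix_odd.
Qed.

(** * Predicates definable in a model with parameters *)

Section Definability.
Variable M : structure.
Local Notation D := (num M).
Local Notation env := (nat -> num M).

Definition form_class (b : bool) (p : form) : Prop :=
  if b then arithmetical p else Delta00 p.

Definition definable_term (f : env -> D) : Prop :=
  exists t v, forall e, teval (mix e v) t = f e.
(* With parameters; [b] selects between arithmetical and Delta^0_0 formulas. *)
Definition definable (b : bool) (P : env -> Prop) : Prop :=
  exists p v X, form_class b p /\ forall e, sat (mix e v) X p <-> P e.

(** A bounded quantifier stays bounded because [up f], applied to a lifted term, yields the lift of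
    the substituted term. *)
Lemma Delta00_subst f g p : Delta00 p -> Delta00 (subst f g p).
Proof.
  intros H. revert f g. induction H; intros; try (constructor; auto; fail).
  simpl. change (scons (tvar 0) (fun n => tlift (f n))) with (up f).
  rewrite tsubst_up_tlift. constructor. apply IHDelta00.
Qed.

Lemma arithmetical_subst f g p : arithmetical p -> arithmetical (subst f g p).
Proof.
  revert f g. induction p; simpl; intros; auto. intuition.
Qed.

Lemma form_class_subst b f g p : form_class b p -> form_class b (subst f g p).
Proof. destruct b; [apply arithmetical_subst | apply Delta00_subst]. Qed.

Lemma form_class_bot b : form_class b fbot.
Proof. destruct b; simpl; auto using D_bot. Qed.
Lemma form_class_imp b p q : form_class b p -> form_class b q -> form_class b (fimp p q).
Proof. destruct b; simpl; auto using D_imp. Qed.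

Lemma sat_mix_left v w X Y e p :
  sat (mix e (mix v w)) (mix X Y) (subst (fun n => tvar (mix_left n)) (fun n => n + n) p)
  <-> @sat M (mix e v) X p.
Proof.
  rewrite sat_subst. cbn [teval].
  replace (fun n => mix e (mix v w) (mix_left n)) with (mix e v)
    by (extensionality n; now rewrite mix_mix_left).
  replace (fun n => mix X Y (n + n)) with X; [tauto|].
  extensionality n. now rewrite mix_even.
Qed.

Lemma sat_mix_right v w X Y e p :
  sat (mix e (mix v w)) (mix X Y) (subst (fun n => tvar (mix_right n)) (fun n => S (n + n)) p)
  <-> @sat M (mix e w) Y p.
Proof.
  rewrite sat_subst. cbn [teval].
  replace (fun n => mix e (mix v w) (mix_right n)) with (mix e w)
    by (extensionality n; now rewrite mix_mix_right).
  replace (fun n => mix X Y (S (n + n))) with Y; [tauto|].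
  extensionality n. now rewrite mix_odd.
Qed.

Lemma teval_mix_left v w e t :
  teval (mix e (mix v w)) (tsubst (fun n => tvar (mix_left n)) t) = @teval M (mix e v) t.
Proof.
  rewrite teval_tsubst. cbn [teval]. f_equal. extensionality n. apply mix_mix_left.
Qed.

Lemma teval_mix_right v w e t :
  teval (mix e (mix v w)) (tsubst (fun n => tvar (mix_right n)) t) = @teval M (mix e w) t.
Proof.
  rewrite teval_tsubst. cbn [teval]. f_equal. extensionality n. apply mix_mix_right.
Qed.

Lemma definable_var i : definable_term (fun e => e i).
Proof. exists (tvar (i + i)), (fun _ => zero). intros e. apply mix_even. Qed.
Lemma definable_const a : definable_term (fun _ => a).
Proof. now exists (tvar 1), (fun _ => a). Qed.
Lemma definable_add f g :
  definable_term f -> definable_term g -> definable_term (fun e => add (f e) (g e)).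
Proof.
  intros (s & v & Hs) (t & w & Ht).
  exists (tadd (tsubst (fun n => tvar (mix_left n)) s)
               (tsubst (fun n => tvar (mix_right n)) t)), (mix v w).
  intros e. cbn [teval]. now rewrite teval_mix_left, teval_mix_right, Hs, Ht.
Qed.
Lemma definable_mul f g :
  definable_term f -> definable_term g -> definable_term (fun e => mul (f e) (g e)).
Proof.
  intros (s & v & Hs) (t & w & Ht).
  exists (tmul (tsubst (fun n => tvar (mix_left n)) s)
               (tsubst (fun n => tvar (mix_right n)) t)), (mix v w).
  intros e. cbn [teval]. now rewrite teval_mix_left, teval_mix_right, Hs, Ht.
Qed.

Lemma definable_ext b P Q :
  (forall e, P e <-> Q e) -> definable b P -> definable b Q.
Proof.
  intros H (p & v & X & Hp & HP). exists p, v, X. split; auto.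
  intros e. now rewrite HP.
Qed.

Lemma definable_eq b f g :
  definable_term f -> definable_term g -> definable b (fun e => f e = g e).
Proof.
  intros (s & v & Hs) (t & w & Ht).
  exists (feq (tsubst (fun n => tvar (mix_left n)) s)
               (tsubst (fun n => tvar (mix_right n)) t)), (mix v w), (fun _ => some_set).
  split; [destruct b; simpl; auto using D_eq|].
  intros e. cbn [sat]. now rewrite teval_mix_left, teval_mix_right, Hs, Ht.
Qed.
Lemma definable_lt b f g :
  definable_term f -> definable_term g -> definable b (fun e => lt (f e) (g e)).
Proof.
  intros (s & v & Hs) (t & w & Ht).
  exists (flt (tsubst (fun n => tvar (mix_left n)) s)
               (tsubst (fun n => tvar (mix_right n)) t)), (mix v w), (fun _ => some_set).
  split; [destruct b; simpl; auto using D_lt|].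
  intros e. cbn [sat]. now rewrite teval_mix_left, teval_mix_right, Hs, Ht.
Qed.
Lemma definable_mem b f Y :
  definable_term f -> definable b (fun e => mem (f e) Y).
Proof.
  intros (s & v & Hs). exists (fin s 0), v, (fun _ => Y).
  split; [destruct b; simpl; auto using D_in|].
  intros e. cbn [sat]. now rewrite Hs.
Qed.
Lemma definable_False b : definable b (fun _ => False).
Proof.
  exists fbot, (fun _ => zero), (fun _ => some_set).
  split; [apply form_class_bot | reflexivity].
Qed.
Lemma definable_imp b P Q :
  definable b P -> definable b Q -> definable b (fun e => P e -> Q e).
Proof.
  intros (p & v & X & Hp & HP) (q & w & Y & Hq & HQ).
  exists (fimp (subst (fun n => tvar (mix_left n)) (fun n => n + n) p)
               (subst (fun n => tvar (mix_right n)) (fun n => S (n + n)) q)),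
    (mix v w), (mix X Y).
  split; [apply form_class_imp; now apply form_class_subst|].
  intros e. cbn [sat]. now rewrite sat_mix_left, sat_mix_right, HP, HQ.
Qed.

Lemma sat_mix_bind a e v X p :
  sat (scons a (mix e v)) X (subst (fun n => tvar (mix_bind n)) (fun Y => Y) p)
  <-> @sat M (mix (scons a e) v) X p.
Proof.
  rewrite sat_subst. cbn [teval].
  replace (fun n => scons a (mix e v) (mix_bind n)) with (mix (scons a e) v); [tauto|].
  extensionality n. now rewrite mix_mix_bind.
Qed.

(** Separating the bound value from the environment gives the conclusion the shape in which
    quantifiers occur in practice; in the hypothesis the bound variable has index 0 and the others
    are shifted. *)
Lemma definable_ball b (f : env -> D) (P : env -> D -> Prop) :
  definable_term f -> definable b (fun e => P (fun i => e (S i)) (e 0)) ->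
  definable b (fun e => forall a, lt a (f e) -> P e a).
Proof.
  intros (t & v & Ht) (p & w & X & Hp & HP).
  set (t' := tsubst (fun n => tvar (mix_left n)) t).
  set (p' := subst (fun n => tvar (mix_bind n)) (fun Y => Y)
        (subst (fun n => tvar (mix_right n)) (fun n => n) p)).
  exists (fall1 (fimp (flt (tvar 0) (tlift t')) p')), (mix v w), X.
  split.
  - assert (form_class b p') by now do 2 apply form_class_subst.
    destruct b; simpl; auto. now apply D_ball.
  - intros e. cbn [sat]. apply forall_iff. intros a.
    rewrite teval_tlift. unfold t', p'. rewrite teval_mix_left, Ht.
    rewrite sat_mix_bind, sat_subst. cbn [teval].
    replace (fun n => mix (scons a e) (mix v w) (mix_right n)) with (mix (scons a e) w)
      by (extensionality n; now rewrite mix_mix_right).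
    now rewrite HP.
Qed.

Lemma definable_all (P : env -> D -> Prop) :
  definable true (fun e => P (fun i => e (S i)) (e 0)) ->
  definable true (fun e => forall a, P e a).
Proof.
  intros (p & w & X & Hp & HP).
  exists (fall1 (subst (fun n => tvar (mix_bind n)) (fun Y => Y) p)), w, X.
  split; [simpl; now apply arithmetical_subst|].
  intros e. cbn [sat]. apply forall_iff. intros a.
  now rewrite sat_mix_bind, HP.
Qed.

Lemma definable_not b P : definable b P -> definable b (fun e => ~ P e).
Proof. intros. apply definable_imp; auto using definable_False. Qed.

Lemma definable_and b P Q :
  definable b P -> definable b Q -> definable b (fun e => P e /\ Q e).
Proof.
  intros HP HQ.
  apply definable_ext with (fun e => ~ (P e -> ~ Q e)); [intros; tauto|].
  now apply definable_not, definable_imp, definable_not.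
Qed.

Lemma definable_or b P Q :
  definable b P -> definable b Q -> definable b (fun e => P e \/ Q e).
Proof.
  intros HP HQ.
  apply definable_ext with (fun e => ~ P e -> Q e); [intros; tauto|].
  now apply definable_imp, HQ; apply definable_not.
Qed.

Lemma definable_iff b P Q :
  definable b P -> definable b Q -> definable b (fun e => P e <-> Q e).
Proof. intros HP HQ. apply definable_and; now apply definable_imp. Qed.

Lemma definable_bex b (f : env -> D) (P : env -> D -> Prop) :
  definable_term f -> definable b (fun e => P (fun i => e (S i)) (e 0)) ->
  definable b (fun e => exists a, lt a (f e) /\ P e a).
Proof.
  intros Hf HP.
  apply definable_ext with (fun e => ~ (forall a, lt a (f e) -> ~ P e a)).
  - intros e. split.
    + intros H. apply NNPP. intros H'. apply H. intros a Ha HPa.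
      apply H'. now exists a.
    + intros (a & Ha & HPa) H. exact (H a Ha HPa).
  - apply definable_not, (definable_ball b f (fun e a => ~ P e a)); auto.
    now apply definable_not.
Qed.

Lemma definable_ex (P : env -> D -> Prop) :
  definable true (fun e => P (fun i => e (S i)) (e 0)) ->
  definable true (fun e => exists a, P e a).
Proof.
  intros HP.
  apply definable_ext with (fun e => ~ (forall a, ~ P e a)).
  - intros e. split.
    + intros H. apply NNPP. intros H'. apply H. intros a HPa.
      apply H'. now exists a.
    + intros (a & HPa) H. exact (H a HPa).
  - apply definable_not, (definable_all (fun e a => ~ P e a)).
    now apply definable_not.
Qed.

Lemma definable_term_rename f (r : nat -> nat) :
  definable_term f -> definable_term (fun e => f (fun i => e (r i))).
Proof.
  intros (t & v & Ht).
  exists (tsubst (fun n => tvar (if Nat.even n then r (Nat.div2 n) + r (Nat.div2 n) else n)) t), v.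
  intros e. rewrite teval_tsubst, <- Ht. cbn [teval]. f_equal. extensionality n.
  destruct (even_odd_cases n) as [i [-> | ->]].
  - rewrite even_double, !mix_even. f_equal. f_equal.
    replace (i + i) with (2 * i) by lia. apply Nat.div2_double.
  - now rewrite even_double_succ, !mix_odd.
Qed.

Lemma definable_rename b P (r : nat -> nat) :
  definable b P -> definable b (fun e => P (fun i => e (r i))).
Proof.
  intros (p & v & X & Hp & HP).
  exists (subst (fun n => tvar (if Nat.even n then r (Nat.div2 n) + r (Nat.div2 n) else n))
    (fun n => n) p), v, X.
  split; [now apply form_class_subst|].
  intros e. rewrite sat_subst, <- (HP (fun i => e (r i))). cbn [teval].
  match goal with |- sat ?a _ _ <-> sat ?b _ _ => replace a with b; [tauto|] end.
  extensionality n. destruct (even_odd_cases n) as [i [-> | ->]].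
  - rewrite even_double, !mix_even. do 2 f_equal.
    replace (i + i) with (2 * i) by lia. symmetry. apply Nat.div2_double.
  - now rewrite even_double_succ, !mix_odd.
Qed.

Lemma definable_push b P f :
  definable_term f -> definable b P -> definable b (fun e => P (scons (f e) e)).
Proof.
  intros (t & v & Ht) (p & w & X & Hp & HP).
  exists (subst (fun n => match mix_bind n with
                          | 0 => tsubst (fun n => tvar (mix_left n)) t
                          | S m => tvar (mix_right m) end) (fun n => n) p), (mix v w), X.
  split; [now apply form_class_subst|].
  intros e. rewrite sat_subst, <- HP.
  match goal with |- sat ?a _ _ <-> sat ?b _ _ => replace a with b; [tauto|] end.
  extensionality n. rewrite <- mix_mix_bind. destruct (mix_bind n).
  - now rewrite teval_mix_left, Ht.
  - cbn [scons teval]. now rewrite mix_mix_right.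
Qed.

(** Only [e 0] remains a variable; the infinite tail [v] joins the parameter list. In this way a
    formula under an arbitrary valuation is fed to comprehension. *)
Lemma definable_parameters b P v : definable b P -> definable b (fun e => P (scons (e 0) v)).
Proof.
  intros (p & w & X & Hp & HP).
  exists (subst (fun n => tvar (match n with
    | 0 => 0 | S m => if Nat.even n then 2 * m - 1 else 2 * n + 1 end)) (fun n => n) p),
    (mix v w), X.
  split; [now apply form_class_subst|].
  intros e. rewrite sat_subst, <- HP. cbn [teval].
  match goal with |- sat ?a _ _ <-> sat ?b _ _ => replace a with b; [tauto|] end.
  extensionality n. destruct (even_odd_cases n) as [i [-> | ->]].
  - rewrite mix_even. destruct i as [|i]; [reflexivity|]. rewrite even_double.
    cbn [scons Nat.add]. replace (2 * (i + S i) - 1) with (S ((i + i) + (i + i))) by lia.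
    now rewrite mix_odd, mix_even.
  - rewrite even_double_succ.
    replace (2 * S (i + i) + 1) with (S (S (i + i) + S (i + i))) by lia.
    now rewrite !mix_odd.
Qed.

Lemma definable_subst1 b (P : D -> Prop) f :
  definable b (fun e => P (e 0)) -> definable_term f -> definable b (fun e => P (f e)).
Proof. intros HP Hf. exact (definable_push b _ f Hf HP). Qed.

Lemma definable_subst2 b (P : D -> D -> Prop) f g :
  definable b (fun e => P (e 0) (e 1)) -> definable_term f -> definable_term g ->
  definable b (fun e => P (f e) (g e)).
Proof.
  intros HP Hf Hg. apply (definable_term_rename f S) in Hf.
  exact (definable_push b _ g Hg (definable_push b _ _ Hf HP)).
Qed.

End Definability.

Lemma teval_bound {M : structure} (v w : nat -> num M) t :
  (forall i, i < tbound t -> v i = w i) -> teval v t = teval w t.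
Proof.
  induction t; simpl; intros H; auto; f_equal;
    (apply IHt1 || apply IHt2); intros; apply H; lia.
Qed.

Lemma sat_bound {M : structure} (v w : nat -> num M) X p :
  (forall i, i < bound1 p -> v i = w i) -> (sat v X p <-> sat w X p).
Proof.
  revert v w X. induction p; simpl; intros v w Z H.
  - tauto.
  - now rewrite (teval_bound v w s), (teval_bound v w t) by (intros; apply H; lia).
  - now rewrite (teval_bound v w s), (teval_bound v w t) by (intros; apply H; lia).
  - now rewrite (teval_bound v w t).
  - rewrite (IHp1 v w), (IHp2 v w); [tauto| |]; intros; apply H; lia.
  - apply forall_iff. intros a. apply IHp. intros [|i] Hi; [reflexivity|].
    apply H. lia.
  - apply forall_iff. intros Y. now apply IHp.
Qed.

Declare Scope num_scope.
Delimit Scope num_scope with num.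
Notation "0" := (@zero _) : num_scope.
Notation "1" := (@one _) : num_scope.
Infix "+" := add : num_scope.
Infix "*" := mul : num_scope.
Infix "<" := lt : num_scope.
Notation "a <= b" := (lt a (add b one)) : num_scope.

(** * Coded finite sets, sequences and trees: semantics *)

Section Coding_defs.
Context {M : structure}.
Local Notation D := (num M).
Local Open Scope num_scope.
Implicit Types a b c i j k l m n x y s t : D.

Definition dvd a b : Prop := exists q, a * q = b.
Definition pair a b : D := (a + b) * (a + b) + a.
Definition Rep c : Prop := exists k m n, c = pair k (pair m n).
Definition Elem i c : Prop := exists k m n,
  c = pair k (pair m n) /\ i < k /\ dvd (m * (i + 1) + 1) n.
Definition Finset c : Prop :=
  Rep c /\ forall d, d < c /\ Rep d -> ~ forall i, Elem i d <-> Elem i c.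
Definition Entry s i x : Prop := Elem (pair i x) s.
Definition Lh s l : Prop := forall i, i < l <-> exists x, Entry s i x.
Definition FinSeq s : Prop :=
  Finset s
  /\ (forall p, Elem p s -> exists i x, p = pair i x)
  /\ (forall i x y, Entry s i x -> Entry s i y -> x = y)
  /\ exists l, Lh s l.
Definition BinSeq s : Prop := FinSeq s /\ forall i x, Entry s i x -> x = 0 \/ x = 1.
Definition Initseg s t : Prop := forall p, Elem p s -> Elem p t.
Definition ImmSucc s t : Prop := Initseg s t /\ exists l, Lh s l /\ Lh t (l + 1).
Definition CardEq F k : Prop := exists s, FinSeq s /\ Lh s k
  /\ (forall a, Elem a F <-> exists i, Entry s i a)
  /\ (forall i j x, Entry s i x -> Entry s j x -> i = j).
Definition CardLe F c : Prop := exists k, CardEq F k /\ k <= c.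

End Coding_defs.

Section Sat_iff.
Context {M : structure} (v : nat -> num M) (X : nat -> sets M).

Lemma sat_fall1_iff p (P : num M -> Prop) :
  (forall a, sat (scons a v) X p <-> P a) -> (sat v X (fall1 p) <-> forall a, P a).
Proof. apply forall_iff. Qed.
Lemma sat_fall2_iff p (P : sets M -> Prop) :
  (forall Y, sat v (scons Y X) p <-> P Y) -> (sat v X (fall2 p) <-> forall Y, P Y).
Proof. apply forall_iff. Qed.
Lemma sat_fex1_iff p (P : num M -> Prop) :
  (forall a, sat (scons a v) X p <-> P a) -> (sat v X (fex1 p) <-> exists a, P a).
Proof. intros H. rewrite sat_fex1. now setoid_rewrite H. Qed.
Lemma sat_fex2_iff p (P : sets M -> Prop) :
  (forall Y, sat v (scons Y X) p <-> P Y) -> (sat v X (fex2 p) <-> exists Y, P Y).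
Proof. intros H. rewrite sat_fex2. now setoid_rewrite H. Qed.
Lemma sat_fimp_iff p q (P Q : Prop) :
  (sat v X p <-> P) -> (sat v X q <-> Q) -> (sat v X (fimp p q) <-> (P -> Q)).
Proof. cbn [sat]. tauto. Qed.
Lemma sat_fneg_iff p (P : Prop) :
  (sat v X p <-> P) -> (sat v X (fneg p) <-> ~ P).
Proof. rewrite sat_fneg. tauto. Qed.
Lemma sat_fand_iff p q (P Q : Prop) :
  (sat v X p <-> P) -> (sat v X q <-> Q) -> (sat v X (fand p q) <-> P /\ Q).
Proof. rewrite sat_fand. tauto. Qed.
Lemma sat_for_iff p q (P Q : Prop) :
  (sat v X p <-> P) -> (sat v X q <-> Q) -> (sat v X (for_ p q) <-> P \/ Q).
Proof. rewrite sat_for. tauto. Qed.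
Lemma sat_fiff_iff p q (P Q : Prop) :
  (sat v X p <-> P) -> (sat v X q <-> Q) -> (sat v X (fiff p q) <-> (P <-> Q)).
Proof. rewrite sat_fiff. tauto. Qed.
End Sat_iff.

Lemma teval_tpair {M : structure} (v : nat -> num M) s t :
  teval v (tpair s t) = pair (teval v s) (teval v t).
Proof. reflexivity. Qed.

Ltac sat_iff :=
  lazymatch goal with
  | |- sat _ _ (fall1 _) <-> _ => apply sat_fall1_iff; intros ?; sat_iff
  | |- sat _ _ (fall2 _) <-> _ => apply sat_fall2_iff; intros ?; sat_iff
  | |- sat _ _ (fex1 _) <-> _ => apply sat_fex1_iff; intros ?; sat_iff
  | |- sat _ _ (fex2 _) <-> _ => apply sat_fex2_iff; intros ?; sat_iff
  | |- sat _ _ (fimp _ _) <-> _ => apply sat_fimp_iff; sat_iff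
  | |- sat _ _ (fneg _) <-> _ => apply sat_fneg_iff; sat_iff
  | |- sat _ _ (fand _ _) <-> _ => apply sat_fand_iff; sat_iff
  | |- sat _ _ (for_ _ _) <-> _ => apply sat_for_iff; sat_iff
  | |- sat _ _ (fiff _ _) <-> _ => apply sat_fiff_iff; sat_iff
  | |- _ =>
      repeat first [progress autorewrite with sat | progress cbn [sat teval scons]];
      reflexivity
  end.

Create HintDb sat.
#[local] Hint Rewrite @teval_tpair @teval_tlift : sat.

Lemma sat_divides {M : structure} (v : nat -> num M) X s t :
  sat v X (divides s t) <-> dvd (teval v s) (teval v t).
Proof. unfold divides, dvd. sat_iff. Qed.
#[local] Hint Rewrite @sat_divides : sat.

Lemma sat_represents {M : structure} (v : nat -> num M) X c :
  sat v X (represents c) <-> Rep (teval v c).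
Proof. unfold represents, Rep. sat_iff. Qed.
#[local] Hint Rewrite @sat_represents : sat.

Lemma sat_elem {M : structure} (v : nat -> num M) X i c :
  sat v X (elem i c) <-> Elem (teval v i) (teval v c).
Proof. unfold elem, Elem. sat_iff. Qed.
#[local] Hint Rewrite @sat_elem : sat.

Lemma sat_finset {M : structure} (v : nat -> num M) X c :
  sat v X (finset c) <-> Finset (teval v c).
Proof. unfold finset, Finset. sat_iff. Qed.
#[local] Hint Rewrite @sat_finset : sat.

Lemma sat_entry {M : structure} (v : nat -> num M) X s i x :
  sat v X (entry s i x) <-> Entry (teval v s) (teval v i) (teval v x).
Proof. unfold entry, Entry. now rewrite sat_elem. Qed.
#[local] Hint Rewrite @sat_entry : sat.

Lemma sat_lh {M : structure} (v : nat -> num M) X s l :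
  sat v X (lh s l) <-> Lh (teval v s) (teval v l).
Proof. unfold lh, Lh. sat_iff. Qed.
#[local] Hint Rewrite @sat_lh : sat.

Lemma sat_finseq {M : structure} (v : nat -> num M) X s :
  sat v X (finseq s) <-> FinSeq (teval v s).
Proof. unfold finseq, FinSeq. sat_iff. Qed.
#[local] Hint Rewrite @sat_finseq : sat.

Lemma sat_binseq {M : structure} (v : nat -> num M) X s :
  sat v X (binseq s) <-> BinSeq (teval v s).
Proof. unfold binseq, BinSeq. sat_iff. Qed.
#[local] Hint Rewrite @sat_binseq : sat.

Lemma sat_initseg {M : structure} (v : nat -> num M) X s t :
  sat v X (initseg s t) <-> Initseg (teval v s) (teval v t).
Proof. unfold initseg, Initseg. sat_iff. Qed.
#[local] Hint Rewrite @sat_initseg : sat.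

Lemma sat_imm_succ {M : structure} (v : nat -> num M) X s t :
  sat v X (imm_succ s t) <-> ImmSucc (teval v s) (teval v t).
Proof. unfold imm_succ, ImmSucc. sat_iff. Qed.
#[local] Hint Rewrite @sat_imm_succ : sat.

Lemma sat_card_le {M : structure} (v : nat -> num M) X F c :
  sat v X (card_le F c) <-> CardLe (teval v F) (teval v c).
Proof. unfold card_le, CardLe, card_eq, CardEq, fle. sat_iff. Qed.
#[local] Hint Rewrite @sat_card_le : sat.

Section Trees_defs.
Context {M : structure}.
Local Notation D := (num M).
Local Open Scope num_scope.
Implicit Types (T : D -> Prop) (f g X : sets M) (s t n : D).

Definition IsFun f : Prop :=
  (forall p, mem p f -> exists x y, p = pair x y)
  /\ (forall x, exists y, mem (pair x y) f)
  /\ (forall x y z, mem (pair x y) f -> mem (pair x z) f -> y = z).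
Definition InSet X s : Prop := mem s X.
Definition InRange g s : Prop := exists x, mem (pair x s) g.
Definition Infinite T : Prop := forall n, exists s, n < s /\ T s.
Definition Tree T : Prop :=
  (forall s, T s -> FinSeq s)
  /\ (forall s t, T s /\ FinSeq t /\ Initseg t s -> T t).
Definition Binary T : Prop := forall s, T s -> BinSeq s.
Definition FinBranching T : Prop :=
  forall s, T s -> exists b, forall t, T t /\ ImmSucc s t -> t < b.
Definition Extendible T s : Prop :=
  T s /\ forall n, exists t l, T t /\ Initseg s t /\ Lh t l /\ n < l.
Definition ExtLevel T n s : Prop := T s /\ Lh s n /\ Extendible T s.
Definition ExtBounded T : Prop := exists c, forall n F,
  Finset F /\ (forall a, Elem a F -> ExtLevel T n a) -> CardLe F c.
Definition Path T f : Prop :=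
  IsFun f /\ forall s, FinSeq s /\ (forall p, Elem p s -> mem p f) -> T s.

Definition WKL_principle : Prop := forall g,
  IsFun g /\ Tree (InRange g) /\ Binary (InRange g) /\ Infinite (InRange g)
  /\ ExtBounded (InRange g) -> exists f, Path (InRange g) f.
Definition KL_principle : Prop := forall X,
  Tree (InSet X) /\ FinBranching (InSet X) /\ Infinite (InSet X)
  /\ ExtBounded (InSet X) -> exists f, Path (InSet X) f.

End Trees_defs.
Arguments WKL_principle : clear implicits.
Arguments KL_principle : clear implicits.

Lemma sat_inrange {M : structure} (v : nat -> num M) X g t :
  sat v X (inrange g t) <-> InRange (X g) (teval v t).
Proof. unfold inrange, InRange. sat_iff. Qed.
#[local] Hint Rewrite @sat_inrange : sat.

Lemma sat_WKL (M : structure) v X : @sat M v X Sigma01_WKL_ext_bd <-> WKL_principle M.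
Proof.
  unfold Sigma01_WKL_ext_bd, tree, binary, infinite, ext_bounded, ext_level,
    extendible, path, isfun, WKL_principle, Tree, Binary, Infinite, ExtBounded, ExtLevel,
    Extendible, Path, IsFun. sat_iff.
Qed.

Lemma sat_KL (M : structure) v X : @sat M v X KL_ext_bd <-> KL_principle M.
Proof.
  unfold KL_ext_bd, tree, finitely_branching, infinite, ext_bounded, ext_level,
    extendible, path, isfun, inset, KL_principle, Tree, FinBranching, Infinite, ExtBounded,
    ExtLevel, Extendible, Path, IsFun, InSet. sat_iff.
Qed.

Lemma definable_pair (M : structure) f g :
  definable_term M f -> definable_term M g -> definable_term M (fun e => pair (f e) (g e)).
Proof.
  intros Hf Hg. unfold pair.
  repeat first [apply definable_add | apply definable_mul | assumption].
Qed.

(** Works by recursion on the shape of the predicate. Bounded quantifiers are recognized before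
    unbounded ones; an implication matches the pattern of a universal quantifier, hence
    [definable_imp] is tried first there. *)
Ltac definable := cbv beta;
  lazymatch goal with
  | |- definable_term _ (fun e => add _ _) => apply definable_add; definable
  | |- definable_term _ (fun e => mul _ _) => apply definable_mul; definable
  | |- definable_term _ (fun e => pair _ _) => apply definable_pair; definable
  | |- definable_term _ _ =>
      first [assumption | apply definable_const | apply definable_var]
  | |- definable _ _ (fun e => False) => apply definable_False
  | |- definable _ _ (fun e => _ = _) => apply definable_eq; definable
  | |- definable _ _ (fun e => lt _ _) => apply definable_lt; definable
  | |- definable _ _ (fun e => mem _ _) => apply definable_mem; definable
  | |- definable _ _ (fun e => ~ _) => apply definable_not; definable
  | |- definable _ _ (fun e => _ /\ _) => apply definable_and; definable
  | |- definable _ _ (fun e => _ \/ _) => apply definable_or; definable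
  | |- definable _ _ (fun e => _ <-> _) => apply definable_iff; definable
  | |- definable _ _ (fun e => forall a, lt a _ -> _) => apply definable_ball; definable
  | |- definable _ _ (fun e => exists a, lt a _ /\ _) => apply definable_bex; definable
  | |- definable _ _ (fun e => forall a, _) =>
      first [apply definable_imp | apply definable_all]; definable
  | |- definable _ true (fun e => exists a, _) => apply definable_ex; definable
  | |- _ => first
      [ assumption
      | solve [auto with definable]
      | match goal with
        | H : definable _ _ (fun e => ?P (e 0%nat)) |- _ =>
            refine (definable_subst1 _ _ P _ H _); definable
        | H : definable _ _ (fun e => ?P (e 0%nat) (e 1%nat)) |- _ =>
            refine (definable_subst2 _ _ P _ _ H _ _); definable
        end ]
  end.

Create HintDb definable.
#[local] Hint Extern 1 (definable_term _ _) => definable : definable.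

(** * Arithmetic in models of RCA0 *)

Class RCA0_model (M : structure) : Prop := RCA0_valid : model RCA0 M.

Section RCA0.
Context {M : structure} {HM : RCA0_model M}.
Local Notation D := (num M).
Local Open Scope num_scope.
Implicit Types a b c d i j k l m n x y s t : D.

Let v0 : nat -> D := fun _ => 0.
Let X0 : nat -> sets M := fun _ => some_set.

Lemma succ_nonzero a : a + 1 <> 0.
Proof. exact (HM _ (RCA0_basic _ ax_succ_nonzero) v0 X0 a). Qed.
Lemma succ_inj a b : a + 1 = b + 1 -> a = b.
Proof. exact (HM _ (RCA0_basic _ ax_succ_inj) v0 X0 a b). Qed.
Lemma add_0_r a : a + 0 = a.
Proof. exact (HM _ (RCA0_basic _ ax_add_zero) v0 X0 a). Qed.
Lemma add_succ_r a b : a + (b + 1) = a + b + 1.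
Proof. exact (HM _ (RCA0_basic _ ax_add_succ) v0 X0 a b). Qed.
Lemma mul_0_r a : a * 0 = 0.
Proof. exact (HM _ (RCA0_basic _ ax_mul_zero) v0 X0 a). Qed.
Lemma mul_succ_r a b : a * (b + 1) = a * b + a.
Proof. exact (HM _ (RCA0_basic _ ax_mul_succ) v0 X0 a b). Qed.
Lemma lt_0_r a : ~ a < 0.
Proof. exact (HM _ (RCA0_basic _ ax_lt_zero) v0 X0 a). Qed.
Lemma lt_succ_r a b : a < b + 1 <-> a < b \/ a = b.
Proof.
  pose proof (HM _ (RCA0_basic _ ax_lt_succ) v0 X0 a b) as H.
  rewrite sat_fiff, sat_for in H. exact H.
Qed.

Lemma mix_scons_tail {A} (d : A) e v (k : nat) :
  mix (scons d e) v (S k) = mix (scons (v 0%nat) e) v (S k).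
Proof. destruct k; reflexivity. Qed.

(** The entries after the first do not depend on [d]; they form the fixed valuation under which an
    axiom scheme with distinguished variable 0 is read. *)
Lemma scons_mix {A} (d : A) e v :
  scons d (fun k : nat => mix (scons (v 0%nat) e) v (S k)) = mix (scons d e) v.
Proof. extensionality n. destruct n; [reflexivity|]. symmetry; apply mix_scons_tail. Qed.

Lemma sat_lift1 a v X p : sat (scons a v) X (lift1 p) <-> @sat M v X p.
Proof. unfold lift1. now rewrite sat_subst. Qed.

(** Under a vacuous quantifier a Delta^0_0 formula becomes Sigma^0_1 or Pi^0_1 at will, so the
    Delta^0_1 scheme applies. *)
Lemma comprehension_D00 (P : D -> Prop) :
  definable M false (fun e => P (e 0%nat)) -> exists X, forall a, mem a X <-> P a.
Proof.
  intros (p & v & X & Hp & HP).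
  set (w := fun k : nat => mix (scons (v 0%nat) v0) v (S k)).
  assert (Hw : forall a, sat (scons a w) X p <-> P a).
  { intros a. unfold w. rewrite scons_mix, HP. reflexivity. }
  assert (Hq : Delta00 (lift1 p)) by now apply Delta00_subst.
  assert (H := HM _ (RCA0_Delta01_comprehension (fex1 (lift1 p)) (fall1 (lift1 p))
     (ex_intro _ _ (conj Hq eq_refl)) (ex_intro _ _ (conj Hq eq_refl))) w X).
  assert (H0 : sat w X (comprehension (fex1 (lift1 p)))).
  { refine (H _). intros a. apply sat_fiff. rewrite sat_fex1. cbn [sat].
    setoid_rewrite sat_lift1. firstorder. }
  unfold comprehension in H0. rewrite sat_fex2 in H0. destruct H0 as [Y HY].
  exists Y. intros a. specialize (HY a). rewrite sat_fiff, sat_lift2, sat_fex1 in HY.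
  setoid_rewrite sat_lift1 in HY. rewrite <- Hw.
  cbn [sat teval scons] in HY. rewrite HY. firstorder.
Qed.

Lemma sat_at_succ a v X p : sat (scons a v) X (at_succ p) <-> @sat M (scons (a + 1) v) X p.
Proof.
  unfold at_succ. rewrite sat_subst.
  match goal with |- sat ?a _ _ <-> sat ?b _ _ => replace a with b; [tauto|] end.
  extensionality n. destruct n; reflexivity.
Qed.

Lemma sat_induction v X p :
  sat v X (induction p) <->
  (@sat M (scons 0 v) X p ->
   (forall a, sat (scons a v) X p -> sat (scons (a + 1) v) X p) ->
   forall a, sat (scons a v) X p).
Proof.
  unfold induction. cbn [sat]. rewrite sat_fand, sat_inst1. cbn [sat teval].
  setoid_rewrite sat_at_succ. tauto.
Qed.

Lemma induction_S01 (P : D -> D -> Prop) :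
  definable M false (fun e => P (e 1%nat) (e 0%nat)) ->
  (exists b, P 0 b) ->
  (forall a, (exists b, P a b) -> exists b, P (a + 1) b) ->
  forall a, exists b, P a b.
Proof.
  intros (p & v & X & Hp & HP).
  set (w := fun k : nat => mix (scons (v 0%nat) v0) v (S k)).
  set (q := subst (fun n : nat => tvar (mix_bind n)) (fun Y => Y) p).
  assert (Hw : forall a, sat (scons a w) X (fex1 q) <-> exists b, P a b).
  { intros a. unfold w, q. rewrite sat_fex1, scons_mix.
    setoid_rewrite sat_mix_bind. setoid_rewrite HP. reflexivity. }
  assert (Hq : Delta00 q) by now apply Delta00_subst.
  assert (H := HM _ (RCA0_Sigma01_induction (fex1 q) (ex_intro _ _ (conj Hq eq_refl))) w X).
  rewrite sat_induction in H.
  setoid_rewrite Hw in H. exact H.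
Qed.

Lemma induction_D00 (P : D -> Prop) :
  definable M false (fun e => P (e 0%nat)) ->
  P 0 -> (forall a, P a -> P (a + 1)) -> forall a, P a.
Proof.
  intros HP H0 HS a.
  destruct (induction_S01 (fun a b => P a)) with (a := a) as [_ H]; auto.
  - exact (definable_rename M false _ S HP).
  - now exists 0.
  - intros b [_ Hb]. exists 0. auto.
Qed.

Lemma add_0_l a : 0 + a = a.
Proof.
  revert a. apply induction_D00; [definable | apply add_0_r|].
  intros a H. now rewrite add_succ_r, H.
Qed.
Lemma add_succ_l a b : a + 1 + b = a + b + 1.
Proof.
  revert b. apply induction_D00; [definable | now rewrite !add_0_r|].
  intros b H. now rewrite !add_succ_r, H.
Qed.
Lemma add_comm a b : a + b = b + a.
Proof.
  revert b. apply induction_D00; [definable | now rewrite add_0_r, add_0_l|].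
  intros b H. now rewrite add_succ_r, add_succ_l, H.
Qed.
Lemma add_assoc a b c : a + (b + c) = a + b + c.
Proof.
  revert c. apply induction_D00; [definable | now rewrite !add_0_r|].
  intros c H. now rewrite !add_succ_r, H.
Qed.
Lemma mul_0_l a : 0 * a = 0.
Proof.
  revert a. apply induction_D00; [definable | apply mul_0_r|].
  intros a H. now rewrite mul_succ_r, H, add_0_r.
Qed.
Lemma mul_succ_l a b : (a + 1) * b = a * b + b.
Proof.
  revert b. apply induction_D00; [definable | now rewrite !mul_0_r, add_0_r|].
  intros b H. rewrite !mul_succ_r, H, !add_succ_r, <- !(add_assoc (a * b)).
  now rewrite (add_comm b a).
Qed.
Lemma mul_comm a b : a * b = b * a.
Proof.
  revert b. apply induction_D00; [definable | now rewrite mul_0_r, mul_0_l|].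
  intros b H. now rewrite mul_succ_r, mul_succ_l, H.
Qed.
Lemma mul_1_l a : 1 * a = a.
Proof. rewrite <- (add_0_l 1), mul_succ_l, mul_0_l. apply add_0_l. Qed.
Lemma mul_add_r a b c : a * (b + c) = a * b + a * c.
Proof.
  revert c. apply induction_D00; [definable | now rewrite mul_0_r, !add_0_r|].
  intros c H. now rewrite add_succ_r, !mul_succ_r, H, add_assoc.
Qed.
Lemma mul_assoc a b c : a * (b * c) = a * b * c.
Proof.
  revert c. apply induction_D00; [definable | now rewrite !mul_0_r|].
  intros c H. now rewrite !mul_succ_r, mul_add_r, H.
Qed.

Lemma num_semi_ring : semi_ring_theory (@zero M) one add mul eq.
Proof.
  constructor; auto using add_0_l, add_comm, add_assoc, mul_1_l, mul_0_l, mul_comm, mul_assoc.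
  intros. now rewrite mul_comm, mul_add_r, !(mul_comm p).
Qed.
Add Ring num_ring : num_semi_ring.

Lemma add_cancel_r a b c : a + c = b + c -> a = b.
Proof.
  revert c. apply (induction_D00 (fun c => a + c = b + c -> a = b)); [definable| |].
  - now rewrite !add_0_r.
  - intros c H. rewrite !add_succ_r. intros H'. apply H, succ_inj, H'.
Qed.

Lemma zero_or_succ a : a = 0 \/ exists b, a = b + 1.
Proof.
  destruct (induction_S01 (fun a b => a = 0 \/ a = b + 1)) with (a := a) as [b Hb].
  - definable.
  - exists 0. now left.
  - intros c _. exists c. now right.
  - destruct Hb; eauto.
Qed.

(** Reduces the order to addition, so that later inequalities become ring identities. *)
Lemma lt_iff a b : a < b <-> exists k, b = a + k + 1.
Proof.
  split.
  - revert b.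
    (* With the implication under the existential quantifier the statement is Sigma^0_1 in [b]. *)
    assert (H : forall b, exists k, a < b -> b = a + k + 1).
    { apply induction_S01; [definable| |].
      - exists 0. intros H. now apply lt_0_r in H.
      - intros b [k Hk]. destruct (classic (a < b)) as [H|H].
        + exists (k + 1). intros _. rewrite (Hk H). ring.
        + exists 0. intros H'. apply lt_succ_r in H' as [H'| ->]; [easy|ring]. }
    intros b Hb. destruct (H b) as [k Hk]. exists k. auto.
  - intros [k ->]. revert k. apply induction_D00; [definable| |].
    + rewrite add_0_r. apply lt_succ_r. now right.
    + intros k H. rewrite add_succ_r. apply lt_succ_r. now left.
Qed.

Lemma lt_intro a b k : b = a + k + 1 -> a < b.
Proof. intros. apply lt_iff. eauto. Qed.

Lemma le_iff a b : a <= b <-> exists k, b = a + k.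
Proof.
  rewrite lt_iff. split; intros [k Hk]; exists k.
  - now apply succ_inj.
  - now rewrite Hk.
Qed.

Lemma le_intro a b k : b = a + k -> a <= b.
Proof. intros. apply le_iff. eauto. Qed.

Lemma add_succ_neq a k : a <> a + k + 1.
Proof.
  intros H. apply (succ_nonzero k), (add_cancel_r _ _ a). rewrite add_0_l.
  rewrite H at 2. ring.
Qed.

Lemma lt_irrefl a : ~ a < a.
Proof. intros H. apply lt_iff in H as [k H]. exact (add_succ_neq _ _ H). Qed.
Lemma lt_trans a b c : a < b -> b < c -> a < c.
Proof.
  intros [k ->]%lt_iff [l ->]%lt_iff. apply lt_intro with (k + l + 1). ring.
Qed.
Lemma le_refl a : a <= a.
Proof. apply le_intro with 0. ring. Qed.
Lemma lt_le a b : a < b -> a <= b.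
Proof. intros [k ->]%lt_iff. apply le_intro with (k + 1). ring. Qed.
Lemma le_trans a b c : a <= b -> b <= c -> a <= c.
Proof. intros [k ->]%le_iff [l ->]%le_iff. apply le_intro with (k + l). ring. Qed.
Lemma lt_le_trans a b c : a < b -> b <= c -> a < c.
Proof. intros [k ->]%lt_iff [l ->]%le_iff. apply lt_intro with (k + l). ring. Qed.
Lemma le_lt_trans a b c : a <= b -> b < c -> a < c.
Proof. intros [k ->]%le_iff [l ->]%lt_iff. apply lt_intro with (k + l). ring. Qed.
Lemma le_add_r a b : a <= a + b.
Proof. now apply le_intro with b. Qed.
Lemma le_add_l a b : a <= b + a.
Proof. apply le_intro with b. ring. Qed.
Lemma zero_le a : 0 <= a.
Proof. apply le_intro with a. ring. Qed.
Lemma lt_succ_diag a : a < a + 1.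
Proof. apply le_refl. Qed.

Lemma lt_trichotomy a b : a < b \/ a = b \/ b < a.
Proof.
  revert b. apply induction_D00; [definable| |].
  - right. destruct (zero_or_succ a) as [-> | [c ->]]; [now left|right].
    apply zero_le.
  - intros b [H|[->|H]].
    + left. now apply lt_le.
    + left. apply le_refl.
    + apply lt_iff in H as [k ->]. destruct (zero_or_succ k) as [-> | [l ->]].
      * right. left. ring.
      * right. right. apply lt_intro with l. ring.
Qed.

Lemma le_or_lt a b : a <= b \/ b < a.
Proof.
  destruct (lt_trichotomy a b) as [H|[->|H]]; auto using lt_le, le_refl.
Qed.
Lemma le_not_lt a b : a <= b -> ~ b < a.
Proof. intros H H'. exact (lt_irrefl _ (le_lt_trans _ _ _ H H')). Qed.
Lemma le_antisym a b : a <= b -> b <= a -> a = b.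
Proof.
  intros H H'. destruct (lt_trichotomy a b) as [H0|[H0|H0]]; auto; exfalso.
  - exact (le_not_lt _ _ H' H0).
  - exact (le_not_lt _ _ H H0).
Qed.
Lemma succ_le a b : a < b <-> a + 1 <= b.
Proof.
  rewrite le_iff, lt_iff. split; intros [k ->]; exists k; ring.
Qed.
Lemma le_lt_eq a b : a <= b <-> a < b \/ a = b.
Proof. apply lt_succ_r. Qed.

Lemma mul_eq_0 a b : a * b = 0 -> a = 0 \/ b = 0.
Proof.
  destruct (zero_or_succ a) as [-> | [c ->]]; auto.
  destruct (zero_or_succ b) as [-> | [d ->]]; auto.
  intros H. exfalso. apply (succ_nonzero (c * d + c + d)). rewrite <- H. ring.
Qed.

Lemma least_D00 (P : D -> Prop) a :
  definable M false (fun e => P (e 0%nat)) -> P a ->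
  exists b, P b /\ forall c, c < b -> ~ P c.
Proof.
  intros HP Ha. apply NNPP. intros H.
  assert (H' : forall b, forall c, c < b -> ~ P c).
  { apply (induction_D00 (fun b => forall c, c < b -> ~ P c)).
    - destruct (comprehension_D00 P HP) as [X HX].
      apply definable_ext with (fun e => forall c, c < e 0%nat -> ~ mem c X); [|definable].
      intros e. now setoid_rewrite HX.
    - intros c Hc. now apply lt_0_r in Hc.
    - intros b Hb c Hc. apply lt_succ_r in Hc as [Hc | ->]; auto.
      intros Hc. apply H. exists b. auto. }
  apply (H' (a + 1) a); auto using le_refl.
Qed.

(** * Finite sets and sequences in models of RCA0 *)

Lemma le_pair_l a b : a <= pair a b.
Proof. apply le_intro with ((a + b) * (a + b)). unfold pair. ring. Qed.

Lemma le_pair_r a b : b <= pair a b.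
Proof.
  destruct (zero_or_succ b) as [-> | [c ->]]; [apply zero_le|].
  unfold pair. apply le_intro with ((a + c) * (a + c) + (a + c) + a + a). ring.
Qed.

(** Pairs with sum [r] have values between the square of [r] and the square of [r + 1], the latter
    excluded. *)
Lemma pair_sum_lt a b c d : a + b < c + d -> pair a b < pair c d.
Proof.
  intros [k Hk]%lt_iff. unfold pair. rewrite Hk.
  apply lt_intro with (b + b + a + c + 
     (k * k + (a + b) * k + (a + b) * k + k + k)). ring.
Qed.

Lemma pair_inj a b c d : pair a b = pair c d -> a = c /\ b = d.
Proof.
  intros H. destruct (lt_trichotomy (a + b) (c + d)) as [Hl|[He|Hl]].
  - apply pair_sum_lt in Hl. rewrite H in Hl. now apply lt_irrefl in Hl.
  - unfold pair in H. rewrite He, !(add_comm (_ * _)) in H.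
    apply add_cancel_r in H as ->. split; auto.
    rewrite !(add_comm c) in He. now apply add_cancel_r in He.
  - apply pair_sum_lt in Hl. rewrite H in Hl. now apply lt_irrefl in Hl.
Qed.

(** The source of all bounds: quantifiers over elements, positions and values of a coded object can
    be bounded by its code. *)
Lemma Elem_lt i c : Elem i c -> i < c.
Proof.
  intros (k & m & n & -> & H & _). apply lt_le_trans with k; auto. apply le_pair_l.
Qed.

Lemma Entry_lt s i x : Entry s i x -> i < s /\ x < s.
Proof.
  intros H%Elem_lt.
  split; (eapply le_lt_trans; [|exact H]); [apply le_pair_l|apply le_pair_r].
Qed.

Lemma dvd_bounded a b : dvd a b <-> exists q, q <= b /\ a * q = b.
Proof.
  split; [|intros (q & _ & H); now exists q].
  intros [q <-]. destruct (zero_or_succ a) as [-> | [c ->]].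
  (* A zero divisor gives no bound on the given quotient, but then 0 is a quotient too. *)
  - exists 0. split; [apply zero_le|ring].
  - exists q. split; auto. apply le_intro with (c * q). ring.
Qed.

Lemma Rep_bounded c : Rep c <->
  exists k, k <= c /\ exists m, m <= c /\ exists n, n <= c /\ c = pair k (pair m n).
Proof.
  unfold Rep. split;
    [intros (k & m & n & H) | intros (k & _ & m & _ & n & _ & H); now exists k, m, n].
  exists k. split; [rewrite H; apply le_pair_l|].
  exists m. split; [rewrite H; eapply le_trans; [apply le_pair_l|apply le_pair_r]|].
  exists n. split; [rewrite H; eapply le_trans; [|apply le_pair_r]; apply le_pair_r|auto].
Qed.

Lemma Elem_bounded i c : Elem i c <->
  exists k, k <= c /\ exists m, m <= c /\ exists n, n <= c /\
  (c = pair k (pair m n) /\ i < k /\ exists q, q <= n /\ (m * (i + 1) + 1) * q = n).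
Proof.
  unfold Elem. setoid_rewrite dvd_bounded. split;
    [intros (k & m & n & H & H') | intros (k & _ & m & _ & n & _ & H); now exists k, m, n].
  exists k. split; [rewrite H; apply le_pair_l|].
  exists m. split; [rewrite H; eapply le_trans; [apply le_pair_l|apply le_pair_r]|].
  exists n. split; [rewrite H; eapply le_trans; [|apply le_pair_r]; apply le_pair_r|auto].
Qed.

Lemma definable_Rep u f : definable_term M f -> definable M u (fun e => Rep (f e)).
Proof.
  intros Hf. refine (definable_subst1 M u Rep f _ Hf).
  eapply definable_ext; [intros e; symmetry; apply Rep_bounded|]. definable.
Qed.
#[local] Hint Resolve definable_Rep : definable.

Lemma definable_Elem u f g : definable_term M f -> definable_term M g ->
  definable M u (fun e => Elem (f e) (g e)).
Proof.
  intros Hf Hg. refine (definable_subst2 M u Elem f g _ Hf Hg).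
  eapply definable_ext; [intros e; symmetry; apply Elem_bounded|]. definable.
Qed.
#[local] Hint Resolve definable_Elem : definable.

Lemma definable_Entry u f g h :
  definable_term M f -> definable_term M g -> definable_term M h ->
  definable M u (fun e => Entry (f e) (g e) (h e)).
Proof. intros. apply definable_Elem; auto. definable. Qed.
#[local] Hint Resolve definable_Entry : definable.

Lemma Finset_bounded c : Finset c <->
  Rep c /\ forall d, d < c -> Rep d -> ~ forall i, i < c -> (Elem i d <-> Elem i c).
Proof.
  unfold Finset. apply and_iff_compat_l. apply forall_iff. intros d. split.
  - intros H Hd Hr Hi. apply H; auto. intros i. split; intros Hc.
    + apply Hi; auto. apply Elem_lt in Hc. eapply lt_trans; eauto.
    + apply Hi; auto. now apply Elem_lt.
  - intros H [Hd Hr] Hi. apply H; auto.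
Qed.

Lemma definable_Finset u f : definable_term M f -> definable M u (fun e => Finset (f e)).
Proof.
  intros Hf. refine (definable_subst1 M u Finset f _ Hf).
  eapply definable_ext; [intros e; symmetry; apply Finset_bounded|]. definable.
Qed.
#[local] Hint Resolve definable_Finset : definable.

Lemma Finset_ext c d :
  Finset c -> Finset d -> (forall i, Elem i c <-> Elem i d) -> c = d.
Proof.
  intros [Hc Hc'] [Hd Hd'] H. destruct (lt_trichotomy c d) as [Hl|[He|Hl]]; auto; exfalso.
  - exact (Hd' c (conj Hl Hc) H).
  - apply (Hc' d (conj Hl Hd)). intros i. symmetry. apply H.
Qed.

Lemma Finset_exists_of_Rep c :
  Rep c -> exists d, Finset d /\ forall i, Elem i d <-> Elem i c.
Proof.
  intros Hc.
  (* Having the same elements is an unbounded condition as it stands; all elements of [c] and of [d]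
     lie below [c + d], which makes it Delta^0_0. *)
  destruct (least_D00 (fun d => Rep d /\ forall i, i < c + d -> (Elem i d <-> Elem i c)) c)
    as (d & [Hd Hd'] & Hl).
  - definable.
  - split; auto. reflexivity.
  - assert (H : forall i, Elem i d <-> Elem i c).
    { intros i. split; intros Hi; apply Hd'; auto; apply Elem_lt in Hi;
        (eapply lt_le_trans; [exact Hi|]); [apply le_add_l|apply le_add_r]. }
    exists d. split; auto. split; auto.
    intros c' [Hlt Hr] He. apply (Hl c' Hlt). split; auto.
    intros i _. rewrite He. apply H.
Qed.

Lemma dvd_refl a : dvd a a.
Proof. exists 1. ring. Qed.
Lemma dvd_mul_l a b c : dvd a b -> dvd a (b * c).
Proof. intros [q <-]. exists (q * c). ring. Qed.
Lemma dvd_mul_r a b c : dvd a b -> dvd a (c * b).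
Proof. intros [q <-]. exists (q * c). ring. Qed.
(** In place of subtraction the two quotients are compared; if the one of [b] were larger, the sum
    would be smaller than its summand [b]. *)
Lemma dvd_add_cancel a b c : dvd a b -> dvd a (b + c) -> dvd a c.
Proof.
  intros [q <-] [r Hr]. destruct (zero_or_succ a) as [-> | [a' ->]].
  - exists 0. rewrite !mul_0_l, add_0_l in *. auto.
  - destruct (le_or_lt q r) as [[k ->]%le_iff|[k ->]%lt_iff].
    + exists k. apply (add_cancel_r _ _ ((a' + 1) * q)).
      rewrite (add_comm c), <- Hr. ring.
    + exists 0. exfalso. apply (add_succ_neq ((a' + 1) * r) (a' * (k + 1) + k + c)).
      rewrite Hr at 1. ring.
Qed.

(* [a] divides [m], so [m (i + 1) + 1] and [m (i + 1 + a) + 1] are coprime. *)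
Lemma modulus_coprime m i a n : dvd a m ->
  let u := m * (i + 1) + 1 in let w := m * (i + a + 1) + 1 in
  (dvd u (n * w) -> dvd u n) /\ (dvd w (n * u) -> dvd w n).
Proof.
  intros Ha u w.
  (* The difference of [n * w] and [n * u] is [n * (m * a)]. A modulus is congruent to 1 modulo [m],
     so the factor [m] cancels; the factor [a] cancels after being completed to [m]. *)
  assert (Hkey : forall j z, dvd (m * (j + 1) + 1) (n * (m * a)) -> z = m * (j + 1) + 1 -> dvd z n).
  { intros j z H ->. 
    assert (Hm : forall r, dvd (m * (j + 1) + 1) (r * m) -> dvd (m * (j + 1) + 1) r).
    { intros r Hr. apply dvd_add_cancel with (r * m * (j + 1)); [now apply dvd_mul_l|].
      exists r. ring. }
    apply Hm. destruct Ha as [q Hq].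
    replace (n * m) with (n * a * q) by (rewrite <- Hq; ring). apply dvd_mul_l.
    apply Hm. replace (n * a * m) with (n * (m * a)) by ring. exact H. }
  split.
  - intros H. apply (Hkey i); [|reflexivity].
    apply dvd_add_cancel with (n * u); [apply dvd_mul_r, dvd_refl|].
    replace (n * u + n * (m * a)) with (n * w) by (unfold u, w; ring). exact H.
  - intros H. apply (Hkey (i + a)); [|reflexivity].
    apply dvd_add_cancel with (n * u); [exact H|].
    replace (n * u + n * (m * a)) with (n * w) by (unfold u, w; ring).
    apply dvd_mul_r, dvd_refl.
Qed.

(** A substitute for the factorial, multiplied by [b + 1] at each step of a Sigma^0_1 induction. *)
Lemma common_multiple b : exists m, m <> 0 /\ forall i, i < b -> dvd (i + 1) m.
Proof.
  revert b.
  assert (H : forall b, exists m, m <> 0 /\ forall i, i < b ->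
             exists q, q <= m /\ (i + 1) * q = m).
  { apply induction_S01.
    - definable.
    - exists 1. split; [|intros i H; now apply lt_0_r in H].
      intros H. apply (succ_nonzero 0). now rewrite add_0_l.
    - intros b (m & Hm & Hd). exists (m * (b + 1)). split.
      + intros [H|H]%mul_eq_0; [easy|]. now apply succ_nonzero in H.
      + intros i Hi. apply dvd_bounded. apply lt_succ_r in Hi as [Hi | ->].
        * apply dvd_mul_l, dvd_bounded, Hd, Hi.
        * apply dvd_mul_r, dvd_refl. }
  intros b. destruct (H b) as (m & Hm & Hd). exists m. split; auto.
  intros i Hi. apply dvd_bounded; auto.
Qed.

(** Goedel's coding: [m] is divisible by all positive differences of indices below [b], so the
    moduli are pairwise coprime, and [n] is the product of those belonging to elements of [X] below
    [j]. Only the quantifier over [n] is unbounded, so Sigma^0_1 induction on [j] suffices. *)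
Lemma Finset_of_set (X : sets M) b :
  exists c, Finset c /\ forall i, Elem i c <-> i < b /\ mem i X.
Proof.
  destruct (common_multiple b) as (m & Hm & Hd).
  assert (Hdiff : forall i j, i < j -> j < b -> exists a, j = i + a /\ dvd a m).
  { intros i j [k ->]%lt_iff Hj. exists (k + 1). split; [ring|].
    apply Hd. eapply le_lt_trans; [|exact Hj].
    apply le_intro with (i + 1). ring. }
  assert (H : forall j, exists n, forall i, i < b ->
     ((exists q, q <= n /\ (m * (i + 1) + 1) * q = n) <-> (i < j /\ mem i X))).
  { apply induction_S01; [definable| |].
    (* The empty product: each modulus exceeds 1, as [m] and [i + 1] are nonzero, and does not
       divide it. *)
    - exists 1. intros i Hi. rewrite <- dvd_bounded. split.
      + intros [q Hq]. exfalso. destruct (zero_or_succ q) as [-> | [q' ->]].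
        * rewrite mul_0_r in Hq. apply (succ_nonzero 0). now rewrite add_0_l.
        * assert (E : m * ((i + 1) * (q' + 1)) = 0).
          { destruct (zero_or_succ (m * ((i + 1) * (q' + 1)))) as [E|[r E]]; auto. exfalso.
            apply (add_succ_neq 1 (r + q')).
            rewrite <- Hq at 1.
            transitivity (m * ((i + 1) * (q' + 1)) + q' + 1); [ring|]. rewrite E. ring. }
          apply mul_eq_0 in E as [E|E]; [easy|].
          apply mul_eq_0 in E as [E|E]; now apply succ_nonzero in E.
      + intros [H _]. now apply lt_0_r in H.
    - intros j [n Hn].
      destruct (classic (j < b /\ mem j X)) as [[Hj Hjm]|Hj].
      + exists (n * (m * (j + 1) + 1)). intros i Hi. rewrite <- dvd_bounded.
        specialize (Hn i Hi). rewrite <- dvd_bounded in Hn.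
        destruct (lt_trichotomy i j) as [Hl|[->|Hl]].
        * destruct (Hdiff _ _ Hl Hj) as (a & -> & Ha).
          transitivity (dvd (m * (i + 1) + 1) n).
          { split; [apply modulus_coprime, Ha | apply dvd_mul_l]. }
          rewrite Hn. split; intros [_ ?]; split; auto. now apply lt_le.
        * split; [intros _; split; auto using le_refl|].
          intros _. apply dvd_mul_r, dvd_refl.
        * destruct (Hdiff _ _ Hl Hi) as (a & -> & Ha).
          transitivity (dvd (m * (j + a + 1) + 1) n).
          { split; [apply modulus_coprime, Ha | apply dvd_mul_l]. }
          rewrite Hn. split; intros [Hx ?]; exfalso.
          -- exact (lt_irrefl _ (lt_trans _ _ _ Hl Hx)).
          -- exact (le_not_lt _ _ Hx Hl).
      + exists n. intros i Hi. rewrite (Hn i Hi). rewrite lt_succ_r.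
        split; [tauto|]. intros [[H| ->] H']; tauto. }
  destruct (H b) as [n Hn].
  destruct (Finset_exists_of_Rep (pair b (pair m n))) as (c & Hc & Hc').
  { now exists b, m, n. }
  exists c. split; auto. intros i. rewrite Hc'. split.
  - intros (k & m' & n' & He & Hi & Hdv).
    apply pair_inj in He as [<- He]. apply pair_inj in He as [<- <-].
    apply Hn; auto. now apply dvd_bounded.
  - intros [Hi Hx]. exists b, m, n. split; auto. split; auto.
    apply dvd_bounded, Hn; auto.
Qed.

Lemma Finset_of_pred (P : D -> Prop) b :
  definable M false (fun e => P (e 0%nat)) ->
  exists c, Finset c /\ forall i, Elem i c <-> i < b /\ P i.
Proof.
  intros HP. destruct (comprehension_D00 P HP) as [X HX].
  destruct (Finset_of_set X b) as (c & Hc & H). exists c. split; auto.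
  intros i. now rewrite H, HX.
Qed.

(** * Finite sequences and initial segments *)

Lemma Lh_unique s l k : Lh s l -> Lh s k -> l = k.
Proof.
  intros Hl Hk. destruct (lt_trichotomy l k) as [H|[H|H]]; auto; exfalso.
  - apply (lt_irrefl l), Hl, Hk, H.
  - apply (lt_irrefl k), Hk, Hl, H.
Qed.

Lemma Lh_le s l : Lh s l -> l <= s.
Proof.
  intros H. destruct (zero_or_succ l) as [-> | [k ->]]; [apply zero_le|].
  destruct (proj1 (H k) (lt_succ_diag k)) as [x Hx]. apply Entry_lt in Hx as [Hx _].
  now apply succ_le in Hx.
Qed.

Lemma Lh_bounded s l : Lh s l <->
  (forall i, i < l -> exists x, x < s /\ Entry s i x) /\
  (forall i, i < s -> forall x, x < s -> Entry s i x -> i < l).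
Proof.
  split.
  - intros H. split.
    + intros i Hi. apply H in Hi as [x Hx]. exists x. split; auto. now apply Entry_lt in Hx.
    + intros i _ x _ Hx. apply H. eauto.
  - intros [H1 H2] i. split.
    + intros Hi. destruct (H1 i Hi) as (x & _ & Hx). eauto.
    + intros [x Hx]. pose proof (Entry_lt _ _ _ Hx). apply (H2 i) with x; tauto.
Qed.

Lemma definable_Lh u f g : definable_term M f -> definable_term M g ->
  definable M u (fun e => Lh (f e) (g e)).
Proof.
  intros Hf Hg. refine (definable_subst2 M u Lh f g _ Hf Hg).
  eapply definable_ext; [intros e; symmetry; apply Lh_bounded|]. definable.
Qed.
#[local] Hint Resolve definable_Lh : definable.

Lemma FinSeq_bounded s : FinSeq s <->
  Finset s
  /\ (forall p, p < s -> Elem p s -> exists i, i < s /\ exists x, x < s /\ p = pair i x)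
  /\ (forall i, i < s -> forall x, x < s -> forall y, y < s ->
        Entry s i x -> Entry s i y -> x = y)
  /\ exists l, l <= s /\ Lh s l.
Proof.
  unfold FinSeq. split; intros (H1 & H2 & H3 & l & H4); split; auto; split; [|split| |split].
  - intros p _ Hp. destruct (H2 p Hp) as (i & x & ->). pose proof (Entry_lt s i x Hp).
    exists i. split; [tauto|]. exists x. tauto.
  - intros i _ x _ y _. apply H3.
  - exists l. auto using Lh_le.
  - intros p Hp. destruct (H2 p (Elem_lt _ _ Hp) Hp) as (i & _ & x & _ & H). eauto.
  - intros i x y Hx Hy. pose proof (Entry_lt _ _ _ Hx). pose proof (Entry_lt _ _ _ Hy).
    apply (H3 i) ; tauto.
  - exists l. tauto.
Qed.

Lemma definable_FinSeq u f : definable_term M f -> definable M u (fun e => FinSeq (f e)).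
Proof.
  intros Hf. refine (definable_subst1 M u FinSeq f _ Hf).
  eapply definable_ext; [intros e; symmetry; apply FinSeq_bounded|]. definable.
Qed.
#[local] Hint Resolve definable_FinSeq : definable.

Lemma FinSeq_length s : FinSeq s -> exists l, Lh s l.
Proof. intros H. apply H. Qed.

Lemma FinSeq_fun s i x y : FinSeq s -> Entry s i x -> Entry s i y -> x = y.
Proof. intros H. apply H. Qed.

Lemma FinSeq_ext s t :
  FinSeq s -> FinSeq t -> (forall i x, Entry s i x <-> Entry t i x) -> s = t.
Proof.
  intros (Hs & Hs' & _) (Ht & Ht' & _) H. apply Finset_ext; auto.
  intros p. split; intros Hp.
  - destruct (Hs' p Hp) as (i & x & ->). now apply H.
  - destruct (Ht' p Hp) as (i & x & ->). now apply H.
Qed.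

Lemma FinSeq_of_pred (P : D -> D -> Prop) l b :
  definable M false (fun e => P (e 0%nat) (e 1%nat)) ->
  (forall i, i < l -> exists x, x < b /\ P i x) ->
  (forall i x y, i < l -> P i x -> P i y -> x = y) ->
  exists s, FinSeq s /\ Lh s l /\ forall i x, Entry s i x <-> i < l /\ P i x.
Proof.
  intros HP Hex Huniq.
  assert (Hdef : definable M false (fun e => exists i, i < l /\ exists x, x < b /\
     (e 0%nat = pair i x /\ P i x))).
  { definable. }
  destruct (Finset_of_pred (fun p => exists i, i < l /\ exists x, x < b /\
     (p = pair i x /\ P i x)) (pair l b) Hdef) as (s & Hs & Hel).
  assert (He : forall i x, Entry s i x <-> i < l /\ P i x).
  { intros i x. unfold Entry. rewrite Hel. split.
    - intros [_ (j & Hj & y & Hy & E & HPy)]. apply pair_inj in E as [-> ->]. auto.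
    - intros [Hi Hx]. assert (Hxb : x < b).
      { destruct (Hex i Hi) as (y & Hy & HPy). now rewrite (Huniq i x y). }
      (* For [i < l] and [x < b] the sum [i + x] is below [l + b], so the pair is below [pair l b],
         the bound chosen for the graph. *)
      split; [|exists i; split; auto; exists x; auto].
      apply pair_sum_lt. apply lt_iff in Hi as [p ->]. apply lt_iff in Hxb as [q ->].
      apply lt_intro with (p + q + 1). ring. }
  assert (HL : Lh s l).
  { intros i. setoid_rewrite He. split; [|now intros [x [Hi _]]].
    intros Hi. destruct (Hex i Hi) as (x & _ & Hx). eauto. }
  exists s. split; [|auto]. split; [auto|split; [|split]]; eauto.
  - intros p Hp. apply Hel in Hp as (_ & i & _ & x & _ & -> & _). eauto.
  - intros i x y Hx Hy. apply He in Hx as [Hi Hx]. apply He in Hy as [_ Hy]. eauto.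
Qed.

Lemma empty_seq : exists s, FinSeq s /\ Lh s 0.
Proof.
  destruct (FinSeq_of_pred (fun _ _ => False) 0 0) as (s & Hs & Hl & _).
  - definable.
  - intros i Hi. now apply lt_0_r in Hi.
  - easy.
  - eauto.
Qed.

Lemma seq_append s l x : FinSeq s -> Lh s l ->
  exists t, FinSeq t /\ Lh t (l + 1) /\
    forall i y, Entry t i y <-> Entry s i y \/ (i = l /\ y = x).
Proof.
  intros Hs Hl.
  destruct (FinSeq_of_pred (fun i y => Entry s i y \/ (i = l /\ y = x)) (l + 1) (s + x + 1))
    as (t & Ht & Htl & He).
  - definable.
  - intros i Hi. apply lt_succ_r in Hi as [Hi | ->].
    + apply Hl in Hi as [y Hy]. exists y. split; auto. apply lt_le.
      eapply lt_le_trans; [apply Entry_lt in Hy; apply Hy|apply le_add_r].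
    + exists x. split; auto. apply le_add_l.
  - intros i y z _ Hy Hz.
    assert (Hnl : forall w, ~ Entry s l w).
    { intros w Hw. apply (lt_irrefl l), Hl. eauto. }
    destruct Hy as [Hy|[Ey ->]], Hz as [Hz|[Ez ->]]; auto.
    + now apply (FinSeq_fun s i).
    + rewrite Ez in Hy. now apply Hnl in Hy.
    + rewrite Ey in Hz. now apply Hnl in Hz.
  - exists t. split; auto. split; auto. intros i y. rewrite He. split; [tauto|].
    intros H. split; auto. destruct H as [H|[-> _]]; [|apply lt_succ_diag].
    apply lt_le, Hl. eauto.
Qed.

Lemma seq_restrict s l k : FinSeq s -> Lh s l -> k <= l ->
  exists t, FinSeq t /\ Lh t k /\ forall i y, Entry t i y <-> i < k /\ Entry s i y.
Proof.
  intros Hs Hl Hk.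
  destruct (FinSeq_of_pred (fun i y => Entry s i y) k s) as (t & Ht & Htl & He).
  - definable.
  - intros i Hi. destruct (proj1 (Hl i)) as [y Hy]; [eapply lt_le_trans; eauto|].
    exists y. split; auto. now apply Entry_lt in Hy.
  - intros i x y _. now apply FinSeq_fun.
  - eauto.
Qed.

Lemma Initseg_of_entries s t : FinSeq s ->
  (forall i x, Entry s i x -> Entry t i x) -> Initseg s t.
Proof.
  intros (_ & Hs & _) H p Hp. destruct (Hs p Hp) as (i & x & ->). now apply H.
Qed.

Lemma Initseg_refl s : Initseg s s.
Proof. intros p. auto. Qed.

Lemma Initseg_trans s t r : Initseg s t -> Initseg t r -> Initseg s r.
Proof. unfold Initseg. auto. Qed.

Lemma Initseg_Lh s t l k : Initseg s t -> Lh s l -> Lh t k -> l <= k.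
Proof.
  intros H Hl Hk. destruct (le_or_lt l k) as [|Hlt]; auto.
  apply Hl in Hlt as [x Hx]. exfalso. apply (lt_irrefl k), Hk. exists x. now apply H.
Qed.

Lemma Initseg_entry s t l i x : FinSeq t -> Initseg s t -> Lh s l ->
  i < l -> Entry t i x -> Entry s i x.
Proof.
  intros Ht H Hl Hi Hx. apply Hl in Hi as [y Hy].
  now rewrite (FinSeq_fun t i x y Ht Hx (H _ Hy)).
Qed.

Lemma Initseg_eq s t l : FinSeq s -> FinSeq t -> Initseg s t -> Lh s l -> Lh t l -> s = t.
Proof.
  intros Hs Ht H Hl Hl'. apply FinSeq_ext; auto. intros i x. split; [apply H|].
  intros Hx. apply (Initseg_entry s t l); auto. apply Hl'. eauto.
Qed.

Lemma Initseg_chain s t r l k : FinSeq s -> FinSeq r ->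
  Initseg s r -> Initseg t r -> Lh s l -> Lh t k -> l <= k -> Initseg s t.
Proof.
  intros Hs Hr H H' Hl Hk Hlk. apply Initseg_of_entries; auto. intros i x Hx.
  apply (Initseg_entry t r k); auto.
  - eapply lt_le_trans; [|exact Hlk]. apply Hl. eauto.
  - now apply H.
Qed.

Lemma Initseg_restrict s l k : FinSeq s -> Lh s l -> k <= l ->
  exists t, FinSeq t /\ Lh t k /\ Initseg t s.
Proof.
  intros Hs Hl Hk. destruct (seq_restrict s l k) as (t & Ht & Htk & He); auto.
  exists t. split; auto. split; auto. apply Initseg_of_entries; auto.
  intros i x Hx. now apply He in Hx.
Qed.

Lemma CardLe_one F :
  Finset F -> (forall a b, Elem a F -> Elem b F -> a = b) -> CardLe F 1.
Proof.
  intros HF Huniq. destruct empty_seq as (s & Hs & Hl).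
  assert (Hse : forall i x, ~ Entry s i x).
  { intros i x Hx. apply (lt_0_r i), Hl. eauto. }
  destruct (classic (exists a, Elem a F)) as [[a Ha]|Hempty].
  - exists 1. split; [|apply le_refl].
    destruct (seq_append s 0 a Hs Hl) as (t & Ht & Htl & He).
    rewrite add_0_l in Htl. exists t. split; auto. split; auto. split.
    + intros b. split.
      * intros Hb. exists 0. apply He. right. split; auto.
      * intros [i Hi]. apply He in Hi as [Hi|[_ ->]]; auto. now apply Hse in Hi.
    + intros i j x Hi Hj. apply He in Hi as [Hi|[-> _]]; [now apply Hse in Hi|].
      apply He in Hj as [Hj|[-> _]]; [now apply Hse in Hj|]. reflexivity.
  - exists 0. split; [|apply zero_le]. exists s. split; auto. split; auto. split.
    + intros b. split; [intros Hb; exfalso; eauto|]. intros [i Hi]. now apply Hse in Hi.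
    + intros i j x Hi. now apply Hse in Hi.
Qed.

(** * Reversals *)

Implicit Types (X Y Z f g : sets M) (T : D -> Prop).

Definition S01_comprehension : Prop :=
  forall Y, exists Z, forall n, mem n Z <-> exists m, mem (pair n m) Y.

(** An instance of Sigma^0_1 bounding. It supplies the bound on values that [FinSeq_of_pred] asks
    for when a function is cut down to a coded sequence. *)
Lemma fun_bounded f l : IsFun f -> exists b, forall i, i < l ->
  exists x, x < b /\ mem (pair i x) f.
Proof.
  intros (_ & Htot & _). revert l. apply induction_S01; [definable| |].
  - exists 0. intros i Hi. now apply lt_0_r in Hi.
  - intros l [b Hb]. destruct (Htot l) as [y Hy]. exists (b + y + 1). intros i Hi.
    apply lt_succ_r in Hi as [Hi | ->].
    + destruct (Hb i Hi) as (x & Hx & Hf). exists x. split; auto.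
      apply lt_le, lt_le_trans with b; auto. apply le_add_r.
    + exists y. split; auto. apply le_add_l.
Qed.

Lemma fun_restrict f l : IsFun f -> exists s, FinSeq s /\ Lh s l /\
  forall i x, Entry s i x <-> i < l /\ mem (pair i x) f.
Proof.
  intros Hf. destruct (fun_bounded f l Hf) as [b Hb].
  apply FinSeq_of_pred with b; auto; [definable|].
  intros i x y _. apply Hf.
Qed.

Lemma Path_restrict T f l : Path T f -> exists s, T s /\ FinSeq s /\ Lh s l /\
  forall i x, Entry s i x <-> i < l /\ mem (pair i x) f.
Proof.
  intros [Hf HT]. destruct (fun_restrict f l Hf) as (s & Hs & Hl & He).
  exists s. split; auto. apply HT. split; auto. intros p Hp.
  destruct (proj1 (proj2 Hs) p Hp) as (i & x & ->). now apply He in Hp.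
Qed.

(** * Trees with at most one extendible node of each length *)

Section Unique_path.
Variables (T : D -> Prop) (Y : sets M) (V : D -> D -> Prop).
Hypothesis T_seq : forall s, T s -> FinSeq s.
Hypothesis T_entry : forall s l i x, T s -> Lh s l -> Entry s i x ->
  (x = 0 /\ forall m, m < l -> ~ mem (pair i m) Y) \/ V i x.
Hypothesis V_fun : forall i x y, V i x -> V i y -> x = y.
Hypothesis V_witness : forall i x, V i x -> x <> 0 /\ exists m, mem (pair i m) Y.

(** [V i x] says that [x] certifies a witness for [i]. When 0 is claimed, a witness [m] is refuted
    by an extension longer than [m], on which the same 0 still stands. *)
Lemma extendible_entry s i x : Extendible T s -> Entry s i x ->
  (x = 0 /\ forall m, ~ mem (pair i m) Y) \/ V i x.
Proof.
  intros [Hs Hext] Hx. destruct (FinSeq_length s (T_seq s Hs)) as [l Hl].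
  destruct (T_entry s l i x Hs Hl Hx) as [[-> _]|]; auto.
  destruct (classic (V i 0)) as [H|H]; auto. left. split; auto. intros m Hm.
  destruct (Hext m) as (t & k & Ht & Hst & Hk & Hmk).
  destruct (T_entry t k i 0 Ht Hk (Hst _ Hx)) as [[_ Hn]|]; auto.
  exact (Hn m Hmk Hm).
Qed.

(** At each position the existence of a witness decides between 0 and a certificate, and
    certificates are unique. *)
Lemma extendible_unique s t n : Extendible T s -> Extendible T t -> Lh s n -> Lh t n -> s = t.
Proof.
  intros Hs Ht Hsn Htn.
  assert (Hle : forall i x, Entry s i x -> Entry t i x).
  { intros i x Hx. assert (Hi : i < n) by (apply Hsn; eauto).
    apply Htn in Hi as [y Hy]. replace x with y; auto.
    destruct (extendible_entry s i x Hs Hx) as [[-> Hnx]|HVx];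
      destruct (extendible_entry t i y Ht Hy) as [[-> Hny]|HVy]; auto.
    - destruct (V_witness _ _ HVy) as [_ [m Hm]]. now apply Hnx in Hm.
    - destruct (V_witness _ _ HVx) as [_ [m Hm]]. now apply Hny in Hm.
    - now apply (V_fun i). }
  apply Initseg_eq with n; auto; try (apply T_seq; (apply Hs || apply Ht)).
  apply Initseg_of_entries; auto. apply T_seq, Hs.
Qed.

Lemma unique_path_ExtBounded : ExtBounded T.
Proof.
  exists 1. intros n F [HF Hel]. apply CardLe_one; auto. intros a b Ha Hb.
  destruct (Hel a Ha) as (_ & Hna & Hea). destruct (Hel b Hb) as (_ & Hnb & Heb).
  now apply extendible_unique with n.
Qed.

(** An entry other than 0 is certified, and a 0 on a path persists to lengths beyond any candidate
    witness. The condition on [f] is quantifier-free, which allows comprehension. *)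
Lemma path_decides f n : Path T f -> (~ mem (pair n 0) f <-> exists m, mem (pair n m) Y).
Proof.
  intros Hf. split.
  - intros Hn. destruct (proj1 (proj2 (proj1 Hf)) n) as [x Hx].
    destruct (Path_restrict T f (n + 1) Hf) as (s & Hs & _ & Hl & He).
    assert (Hsx : Entry s n x) by (apply He; split; auto; apply lt_succ_diag).
    destruct (T_entry s _ n x Hs Hl Hsx) as [[-> _]|HV]; [easy|].
    now apply V_witness in HV.
  - intros [m Hm] Hn.
    (* This length exceeds both the position [n] and the witness [m]. *)
    destruct (Path_restrict T f (n + m + 1) Hf) as (s & Hs & _ & Hl & He).
    assert (Hsx : Entry s n 0) by (apply He; split; auto; apply le_add_r).
    destruct (T_entry s _ n 0 Hs Hl Hsx) as [[_ H]|HV].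
    + apply (H m); auto. apply le_add_l.
    + now apply V_witness in HV as [].
Qed.

Lemma path_comprehension f : Path T f -> exists Z, forall n, mem n Z <-> exists m, mem (pair n m) Y.
Proof.
  intros Hf. destruct (comprehension_D00 (fun n => ~ mem (pair n 0) f)) as [Z HZ]; [definable|].
  exists Z. intros n. rewrite HZ. now apply path_decides.
Qed.

End Unique_path.

Section KL_tree.
Variable Y : sets M.

(** Minimality makes the certificate unique, hence the branching finite. Bounding the predecessor
    [m] by [x] keeps the condition Delta^0_0. *)
Definition least_witness i x : Prop :=
  exists m, m < x /\ (x = m + 1 /\ mem (pair i m) Y /\ forall k, k < m -> ~ mem (pair i k) Y).

(** All quantifiers are bounded, by the code, the length or an entry, so that the tree exists as a
    set. *)
Definition KL_tree s : Prop :=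
  FinSeq s /\ exists l, l <= s /\ (Lh s l /\ forall i, i < l -> forall x, x < s -> Entry s i x ->
    (x = 0 /\ forall m, m < l -> ~ mem (pair i m) Y) \/ least_witness i x).

Lemma least_witness_fun i x y : least_witness i x -> least_witness i y -> x = y.
Proof.
  intros (m & _ & -> & Hm & Hlm) (k & _ & -> & Hk & Hlk). f_equal.
  destruct (lt_trichotomy m k) as [H|[H|H]]; auto; exfalso; [apply (Hlk m)|apply (Hlm k)]; auto.
Qed.

Lemma least_witness_spec i x : least_witness i x -> x <> 0 /\ exists m, mem (pair i m) Y.
Proof. intros (m & _ & -> & Hm & _). split; [apply succ_nonzero|eauto]. Qed.

Lemma least_witness_exists i m : mem (pair i m) Y -> exists k, k <= m /\ least_witness i (k + 1).
Proof.
  intros Hm. destruct (least_D00 (fun m => mem (pair i m) Y) m) as (k & Hk & Hl); auto.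
  { definable. }
  exists k. split.
  - destruct (le_or_lt k m) as [|H]; auto. now apply Hl in H.
  - exists k. auto using lt_succ_diag.
Qed.

Lemma KL_tree_entry s l i x : KL_tree s -> Lh s l -> Entry s i x ->
  (x = 0 /\ forall m, m < l -> ~ mem (pair i m) Y) \/ least_witness i x.
Proof.
  intros (Hs & k & _ & Hk & H) Hl Hx. rewrite (Lh_unique s l k Hl Hk).
  apply H; auto; [apply Hk; eauto|]. now apply Entry_lt in Hx.
Qed.

Lemma KL_tree_intro s l : FinSeq s -> Lh s l ->
  (forall i x, Entry s i x ->
    (x = 0 /\ forall m, m < l -> ~ mem (pair i m) Y) \/ least_witness i x) -> KL_tree s.
Proof.
  intros Hs Hl H. split; auto. exists l. split; [now apply Lh_le|]. split; auto.
Qed.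

Lemma KL_tree_tree : Tree KL_tree.
Proof.
  split; [now intros s []|]. intros s t (Hs & Ht & Hts).
  destruct (FinSeq_length t Ht) as [k Hk]. destruct (FinSeq_length s (proj1 Hs)) as [l Hl].
  pose proof (Initseg_Lh _ _ _ _ Hts Hk Hl) as Hkl.
  apply KL_tree_intro with k; auto. intros i x Hx.
  destruct (KL_tree_entry s l i x Hs Hl (Hts _ Hx)) as [[-> H]|H]; auto.
  left. split; auto. intros m Hm. apply H. eapply lt_le_trans; eauto.
Qed.

(** A successor of [s] appends 0 or the only possible certificate for position [l]; the two
    resulting codes are bounded by their sum. *)
Lemma KL_tree_branching : FinBranching KL_tree.
Proof.
  intros s Hs. destruct (FinSeq_length s (proj1 Hs)) as [l Hl].
  assert (Hx : exists y, forall x, least_witness l x -> x = y).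
  (* The case distinction is made outside the model; without a certificate, [y] is a dummy value. *)
  { destruct (classic (exists y, least_witness l y)) as [[y Hy]|H].
    - exists y. intros x Hx. now apply least_witness_fun with l.
    - exists 0. intros x Hx. exfalso. eauto. }
  destruct Hx as [y Hy].
  destruct (seq_append s l 0 (proj1 Hs) Hl) as (t0 & Ht0 & Hl0 & He0).
  destruct (seq_append s l y (proj1 Hs) Hl) as (t1 & Ht1 & Hl1 & He1).
  exists (t0 + t1 + 1). intros t (Ht & Hst & k & Hk & Htk).
  rewrite (Lh_unique s k l Hk Hl) in Htk.
  assert (Hcase : forall x t', FinSeq t' -> Lh t' (l + 1) ->
     (forall i y, Entry t' i y <-> Entry s i y \/ (i = l /\ y = x)) -> Entry t l x -> t = t').
  { intros x t' Ht' Htl' He Hx. symmetry. apply Initseg_eq with (l + 1); auto; [apply Ht|].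
    apply Initseg_of_entries; auto. intros i z Hz. apply He in Hz as [Hz|[-> ->]]; auto.
    now apply Hst. }
  destruct (proj1 (Htk l) (lt_succ_diag l)) as [x Hx].
  destruct (KL_tree_entry t _ l x Ht Htk Hx) as [[-> _]|HV].
  - rewrite (Hcase 0 t0); auto. apply le_add_r.
  - apply Hy in HV as ->. rewrite (Hcase y t1); auto. apply le_add_l.
Qed.

Lemma KL_tree_infinite : Infinite KL_tree.
Proof.
  (* A sequence of length [l] has a code of at least [l], hence above [n]. Its entries report the
     result of searching for witnesses below [l]. *)
  intros n. set (l := n + 1).
  destruct (FinSeq_of_pred (fun i x => (x = 0 /\ forall m, m < l -> ~ mem (pair i m) Y)
     \/ (x <= l /\ least_witness i x)) l (l + 1))
    as (s & Hs & Hl & He).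
  - unfold least_witness. definable.
  - intros i Hi. destruct (classic (exists m, m < l /\ mem (pair i m) Y)) as [[m [Hm HY]]|H].
    + destruct (least_witness_exists i m HY) as (k & Hk & HV).
      assert (Hkl : k + 1 <= l) by (apply (proj1 (succ_le _ _)); eapply le_lt_trans; eauto).
      exists (k + 1). auto.
    + exists 0. split; [apply zero_le|]. left. split; auto. intros m Hm HY. eauto.
  - intros i x y Hi [[-> Hx]|[Hx Hx']] [[-> Hy]|[Hy Hy']]; auto.
    (* The bound [l] on the certificate puts its witness [m] below [l], where the value 0 rules it
       out. *)
    + destruct Hy' as (m & Hm & -> & HY & _). exfalso. apply (Hx m); auto.
      now apply (proj2 (succ_le _ _)).
    + destruct Hx' as (m & Hm & -> & HY & _). exfalso. apply (Hy m); auto.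
      now apply (proj2 (succ_le _ _)).
    + now apply least_witness_fun with i.
  - exists s. split.
    + apply (proj2 (succ_le _ _)). now apply Lh_le.
    + apply KL_tree_intro with l; auto. intros i x Hx. apply He in Hx. tauto.
Qed.

Lemma KL_principle_comprehension : KL_principle M ->
  exists Z, forall n, mem n Z <-> exists m, mem (pair n m) Y.
Proof.
  intros HKL. destruct (comprehension_D00 KL_tree) as [X HX].
  { unfold KL_tree, least_witness. definable. }
  assert (E : InSet X = KL_tree).
  { extensionality s. apply propositional_extensionality, HX. }
  destruct (HKL X) as [f Hf]; rewrite E in *.
  - split; [apply KL_tree_tree|]. split; [apply KL_tree_branching|].
    split; [apply KL_tree_infinite|].
    apply unique_path_ExtBounded with Y least_witness.
    + now intros s [].
    + exact KL_tree_entry.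
    + exact least_witness_fun.
    + exact least_witness_spec.
  - exact (path_comprehension KL_tree Y least_witness KL_tree_entry least_witness_spec f Hf).
Qed.

End KL_tree.

Section WKL_tree.
Variable Y : sets M.

(* At stage [c], [s] looks like an initial segment of the characteristic function of
   [{i | exists m, (i, m) in Y}]; the final value at [i] is reached once [c] exceeds a witness. *)
Definition WKL_node s c : Prop :=
  FinSeq s /\ exists l, l <= s /\ (Lh s l /\ l <= c /\ forall i, i < l ->
    (Entry s i 0 /\ forall m, m < c -> ~ mem (pair i m) Y) \/
    (Entry s i 1 /\ exists m, m < c /\ mem (pair i m) Y)).

(** The node gives no bound on the stage, so this quantifier is unbounded and the definition is
    Sigma^0_1. *)
Definition WKL_tree s : Prop := exists c, WKL_node s c.

Definition has_witness i x : Prop := x = 1 /\ exists m, mem (pair i m) Y.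

Lemma WKL_node_intro s l c : FinSeq s -> Lh s l -> l <= c -> (forall i, i < l ->
    (Entry s i 0 /\ forall m, m < c -> ~ mem (pair i m) Y) \/
    (Entry s i 1 /\ exists m, m < c /\ mem (pair i m) Y)) -> WKL_node s c.
Proof. intros Hs Hl Hc H. split; auto. exists l. auto using Lh_le. Qed.

(** The clause [l <= c] of [WKL_node] turns absence of witnesses below the stage into absence below
    the length. *)
Lemma WKL_tree_entry s l i x : WKL_tree s -> Lh s l -> Entry s i x ->
  (x = 0 /\ forall m, m < l -> ~ mem (pair i m) Y) \/ has_witness i x.
Proof.
  intros (c & Hs & k & _ & Hk & Hc & H) Hl Hx. rewrite (Lh_unique s l k Hl Hk).
  destruct (H i) as [[H0 Hm]|[H1 (m & _ & Hm)]]; [apply Hk; eauto| |].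
  - left. rewrite (FinSeq_fun s i x 0 Hs Hx H0). split; auto.
    intros m Hmk. apply Hm. eapply lt_le_trans; eauto.
  - right. rewrite (FinSeq_fun s i x 1 Hs Hx H1). split; eauto.
Qed.

Lemma WKL_tree_seq s : WKL_tree s -> FinSeq s.
Proof. now intros (c & Hs & _). Qed.

Lemma WKL_tree_tree : Tree WKL_tree.
Proof.
  split; [apply WKL_tree_seq|]. intros s t ((c & Hs & l & _ & Hl & Hc & H) & Ht & Hts).
  destruct (FinSeq_length t Ht) as [k Hk].
  pose proof (Initseg_Lh _ _ _ _ Hts Hk Hl) as Hkl.
  exists c. apply WKL_node_intro with k; auto; [eapply le_trans; eauto|]. intros i Hi.
  destruct (H i) as [[H0 Hm]|[H1 Hm]]; [eapply lt_le_trans; eauto|left|right]; split; auto;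
    apply (Initseg_entry t s k); auto.
Qed.

Lemma WKL_tree_binary : Binary WKL_tree.
Proof.
  intros s Hs. split; [now apply WKL_tree_seq|]. intros i x Hx.
  destruct (FinSeq_length s (WKL_tree_seq s Hs)) as [l Hl].
  destruct (WKL_tree_entry s l i x Hs Hl Hx) as [[-> _]|[-> _]]; auto.
Qed.

Lemma WKL_tree_infinite : Infinite WKL_tree.
Proof.
  intros n. set (l := n + 1).
  destruct (FinSeq_of_pred (fun i x => (x = 0 /\ forall m, m < l -> ~ mem (pair i m) Y)
     \/ (x = 1 /\ exists m, m < l /\ mem (pair i m) Y)) l (1 + 1))
    as (s & Hs & Hl & He).
  - definable.
  - intros i Hi. destruct (classic (exists m, m < l /\ mem (pair i m) Y)) as [H|H].
    + exists 1. split; auto. apply lt_succ_diag.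
    + exists 0. split; [apply zero_le|]. left. split; auto. intros m Hm HY. eauto.
  - intros i x y _ [[-> Hx]|[-> (m & Hm & Hx)]] [[-> Hy]|[-> (k & Hk & Hy)]]; auto;
      exfalso; [apply (Hx k)|apply (Hy m)]; auto.
  - exists s. split; [apply (proj2 (succ_le _ _)); now apply Lh_le|].
    (* The search went up to [l], so the length itself is the stage. *)
    exists l. apply WKL_node_intro with l; auto using le_refl. intros i Hi. rewrite !He.
    destruct (classic (exists m, m < l /\ mem (pair i m) Y)) as [H|H]; [tauto|].
    left. split; [split; auto; left; split; auto|]; intros m Hm HY; eauto.
Qed.

(** The enumeration sends [pair s c] to [s] if [s] is a node at stage [c], and any other number to
    the empty sequence. With the stage stored in the argument the graph is Delta^0_0, although the
    range is Sigma^0_1. *)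
Lemma WKL_tree_enumeration : exists g, IsFun g /\ InRange g = WKL_tree.
Proof.
  destruct empty_seq as (e & He & Hl).
  assert (Hroot : WKL_node e 0).
  { apply WKL_node_intro with 0; auto using le_refl. intros i Hi. now apply lt_0_r in Hi. }
  set (P x y := exists s, s <= x /\ exists c, c <= x /\ (x = pair s c /\ WKL_node s c /\ y = s)).
  assert (HP : forall s c, WKL_node s c -> P (pair s c) s).
  { intros s c H. exists s. split; [apply le_pair_l|]. exists c. split; [apply le_pair_r|auto]. }
  destruct (comprehension_D00 (fun p => exists x, x <= p /\ exists y, y <= p /\
     (p = pair x y /\ (P x y \/ ((forall z, z <= x -> ~ P x z) /\ y = e))))) as [g Hg].
  { unfold P, WKL_node. definable. }
  assert (Hg' : forall x y, mem (pair x y) g <->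
     (P x y \/ ((forall z, z <= x -> ~ P x z) /\ y = e))).
  { intros x y. rewrite Hg. split.
    - intros (x' & _ & y' & _ & E & H). apply pair_inj in E as [-> ->]. auto.
    - intros H. exists x. split; [apply le_pair_l|]. exists y. split; [apply le_pair_r|auto]. }
  (* Values of [P] are at most the argument, so the bounded search in the default clause of [g]
     misses none. *)
  assert (HPle : forall x y, P x y -> y <= x).
  { intros x y (s & Hs & c & _ & _ & _ & ->). auto. }
  exists g. split; [split; [|split]|].
  - intros p Hp. apply Hg in Hp as (x & _ & y & _ & -> & _). eauto.
  - intros x. setoid_rewrite Hg'. destruct (classic (exists y, P x y)) as [[y Hy]|H]; [eauto|].
    exists e. right. split; auto. intros z _ Hz. eauto.
  - intros x y z Hy Hz. apply Hg' in Hy as [Hy|[Hny ->]], Hz as [Hz|[Hnz ->]]; auto.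
    + destruct Hy as (s & _ & c & _ & -> & _ & ->).
      destruct Hz as (s' & _ & c' & _ & E & _ & ->). now apply pair_inj in E.
    + exfalso. apply (Hnz y); auto.
    + exfalso. apply (Hny z); auto.
  - extensionality s. apply propositional_extensionality. unfold InRange. split.
    + intros [x Hx]. apply Hg' in Hx as [(s' & _ & c & _ & _ & H & ->)|[_ ->]].
      * now exists c.
      * now exists 0.
    + intros [c Hc]. exists (pair s c). apply Hg'. auto.
Qed.

Lemma WKL_principle_comprehension : WKL_principle M ->
  exists Z, forall n, mem n Z <-> exists m, mem (pair n m) Y.
Proof.
  intros HWKL. destruct WKL_tree_enumeration as (g & Hg & E).
  assert (HV : forall i x, has_witness i x -> x <> 0 /\ exists m, mem (pair i m) Y).
  { intros i x [-> H]. split; auto. rewrite <- (add_0_l 1). apply succ_nonzero. }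
  destruct (HWKL g) as [f Hf]; rewrite E in *.
  - split; auto. split; [apply WKL_tree_tree|]. split; [apply WKL_tree_binary|].
    split; [apply WKL_tree_infinite|].
    apply unique_path_ExtBounded with Y has_witness.
    + exact WKL_tree_seq.
    + exact WKL_tree_entry.
    + intros i x y [-> _] [-> _]. reflexivity.
    + exact HV.
  - exact (path_comprehension WKL_tree Y has_witness WKL_tree_entry HV f Hf).
Qed.

End WKL_tree.

(** * Arithmetical comprehension *)

Section Arithmetical_comprehension.
Hypothesis HS : S01_comprehension.

(** Pairing merges only finitely many parameters into one number; therefore the environment is set
    to 0 beyond its first [k] entries. *)
Fixpoint truncate (k : nat) (e : nat -> D) : nat -> D :=
  match k with
  | O => fun _ => 0
  | S k => scons (e 0%nat) (truncate k (fun i : nat => e (S i)))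
  end.

Lemma truncate_lt (k : nat) e (i : nat) : (i < k)%nat -> truncate k e i = e i.
Proof.
  revert e i. induction k; intros e i Hi; [lia|]. destruct i; simpl; auto.
  rewrite IHk; auto. lia.
Qed.

(** The set from [S01_comprehension] absorbs the quantifier: membership in it is Delta^0_0 again,
    with a new set parameter. *)
Lemma definable_S01_unary (P : D -> D -> Prop) :
  definable M false (fun e => P (e 0%nat) (e 1%nat)) ->
  definable M false (fun e => exists a, P a (e 0%nat)).
Proof.
  intros HP.
  destruct (comprehension_D00 (fun p => exists n, n <= p /\ exists a, a <= p /\
    (p = pair n a /\ P a n))) as [Y HY]; [definable|].
  destruct (HS Y) as [Z HZ].
  apply definable_ext with (fun e => mem (e 0%nat) Z); [|definable].
  intros e. rewrite HZ. apply exists_iff. intros a. rewrite HY. split.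
  - intros (n & _ & b & _ & E & H). now apply pair_inj in E as [-> ->].
  - intros H. exists (e 0%nat). split; [apply le_pair_l|]. exists a. split; [apply le_pair_r|auto].
Qed.

(* Two variables at a time are contracted into one by the pairing function. *)
Lemma definable_S01_truncate (k : nat) (P : (nat -> D) -> Prop) : definable M false P ->
  definable M false (fun e => exists a, P (scons a (truncate (S k) e))).
Proof.
  revert P. induction k; intros P HP.
  - apply (definable_S01_unary (fun a n => P (scons a (scons n (fun _ => 0))))).
    apply (definable_rename _ _ _
      (fun i : nat => match i with 0 => 1 | 1 => 2 | _ => 0 end%nat)) in HP.
    apply (definable_push _ _ _ (fun _ => 0) (definable_const _ _)) in HP.
    eapply definable_ext; [|exact HP]. intros e. cbv beta.
    match goal with |- P ?a <-> P ?b => replace a with b; [tauto|] end.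
    extensionality i. destruct i as [|[|i]]; reflexivity.
  (* Variable 1 of [Q] holds the pair of variables 1 and 2 of [P]; decoding is bounded by the pair
     itself. *)
  - set (Q := fun e : nat -> D => exists x, x <= e 1%nat /\ exists y, y <= e 1%nat /\
        (e 1%nat = pair x y /\
         P (scons (e 0%nat) (scons x (scons y (fun i : nat => e (S (S i)))))))).
    assert (HQ : definable M false Q).
    { unfold Q. apply definable_bex; [definable|]. apply definable_bex; [definable|].
      apply definable_and; [definable|].
      apply (definable_rename _ _ _ (fun i : nat => match i with
        | 0 => 2 | 1 => 1 | 2 => 0 | S (S i) => S (S (S i)) end%nat)) in HP.
      eapply definable_ext; [|exact HP]. intros e. cbv beta.
      match goal with |- P ?a <-> P ?b => replace a with b; [tauto|] end.
      extensionality i. destruct i as [|[|[|i]]]; reflexivity. }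
    apply IHk in HQ.
    apply (definable_rename _ _ _
      (fun i : nat => match i with 0 => 0 | S i => S (S (S i)) end%nat)) in HQ.
    apply (definable_push _ _ _ (fun e => pair (e 0%nat) (e 1%nat))) in HQ; [|definable].
    eapply definable_ext; [|exact HQ]. intros e. cbv beta.
    apply exists_iff. intros a. unfold Q. cbn [truncate scons]. split.
    + intros (x & _ & y & _ & E & H). apply pair_inj in E as [<- <-]. exact H.
    + intros H. exists (e 0%nat). split; [apply le_pair_l|].
      exists (e 1%nat). split; [apply le_pair_r|]. auto.
Qed.

Lemma definable_teval (t : term) : definable_term M (fun e => teval e t).
Proof. induction t; cbn [teval]; definable. Qed.

(** Quantifier elimination at the cost of set parameters: by induction on the formula each number
    quantifier becomes membership in a set. *)
Lemma arithmetical_definable (X : nat -> sets M) p :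
  arithmetical p -> definable M false (fun e => sat e X p).
Proof.
  induction p; cbn [arithmetical sat]; intros Hp.
  - definable.
  - apply definable_eq; apply definable_teval.
  - apply definable_lt; apply definable_teval.
  - apply definable_mem; apply definable_teval.
  - apply definable_imp; [apply IHp1|apply IHp2]; apply Hp.
  (* Truncation beyond the free variables of [p] preserves its truth value. *)
  - apply definable_ext with (fun e => ~ exists a, ~ sat (scons a (truncate (S (bound1 p)) e)) X p).
    + intros e. split.
      * intros H a. rewrite (sat_bound _ (scons a (truncate (S (bound1 p)) e))).
        -- apply NNPP. intros H'. eauto.
        -- intros [|i] Hi; [reflexivity|]. cbn [scons]. symmetry. apply truncate_lt. lia.
      * intros H [a Ha]. apply Ha.
        rewrite (sat_bound _ (scons a e)); [apply H|].
        intros [|i] Hi; [reflexivity|]. cbn [scons]. apply truncate_lt. lia.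
    + apply definable_not.
      apply (definable_S01_truncate (bound1 p) (fun e => ~ sat e X p)).
      apply definable_not, IHp, Hp.
  - easy.
Qed.

Lemma ACA0_of_S01_comprehension : model ACA0 M.
Proof.
  intros q Hq. destruct Hq as [q Hq| |q Hq].
  - apply HM, RCA0_basic, Hq.
  - intros v X Y. apply sat_induction. cbn [sat teval scons].
    apply (induction_D00 (fun a => mem a Y)). definable.
  - intros v X. unfold comprehension. apply sat_fex2.
    destruct (comprehension_D00 (fun a => sat (scons a v) X q)) as [Z HZ].
    { exact (definable_parameters M false _ v (arithmetical_definable X q Hq)). }
    exists Z. intros a. rewrite sat_fiff, sat_lift2. apply HZ.
Qed.

End Arithmetical_comprehension.

(** * Arithmetical induction and collection in models of ACA_0 *)

Section ACA0.
Hypothesis HA : model ACA0 M.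

Lemma comprehension_ari (P : D -> Prop) :
  definable M true (fun e => P (e 0%nat)) -> exists X, forall a, mem a X <-> P a.
Proof.
  intros (p & v & X & Hp & HP).
  set (w := fun k : nat => mix (scons (v 0%nat) (fun _ => 0)) v (S k)).
  pose proof (HA _ (ACA0_comprehension p Hp) w X) as H.
  unfold comprehension in H. rewrite sat_fex2 in H. destruct H as [Y HY].
  exists Y. intros a. specialize (HY a). rewrite sat_fiff, sat_lift2 in HY.
  unfold w in HY. rewrite scons_mix, HP in HY. exact HY.
Qed.

Lemma induction_ari (P : D -> Prop) :
  definable M true (fun e => P (e 0%nat)) ->
  P 0 -> (forall a, P a -> P (a + 1)) -> forall a, P a.
Proof.
  intros HP H0 HS a. destruct (comprehension_ari P HP) as [X HX]. apply HX. revert a.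
  apply induction_D00; [definable| |]; [now apply HX|]. intros a. rewrite !HX. auto.
Qed.

Lemma least_ari (P : D -> Prop) a :
  definable M true (fun e => P (e 0%nat)) -> P a ->
  exists b, P b /\ forall c, c < b -> ~ P c.
Proof.
  intros HP Ha. destruct (comprehension_ari P HP) as [X HX].
  destruct (least_D00 (fun b => mem b X) a) as (b & Hb & Hl); [definable|now apply HX|].
  exists b. split; [now apply HX|]. intros c Hc. rewrite <- HX. auto.
Qed.

Lemma collection_ari (P : D -> D -> Prop) b :
  definable M true (fun e => P (e 0%nat) (e 1%nat)) ->
  (forall x c d, P x c -> c <= d -> P x d) ->
  (forall x, x < b -> exists c, P x c) ->
  exists c, forall x, x < b -> P x c.
Proof.
  intros HP Hmono. revert b.
  apply (induction_ari (fun b => (forall x, x < b -> exists c, P x c) ->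
    exists c, forall x, x < b -> P x c)); [definable| |].
  - intros _. exists 0. intros x Hx. now apply lt_0_r in Hx.
  - intros b IH Hb. destruct IH as [c Hc].
    + intros x Hx. apply Hb. now apply lt_le.
    + destruct (Hb b (lt_succ_diag b)) as [d Hd]. exists (c + d). intros x Hx.
      apply lt_succ_r in Hx as [Hx | ->].
      * apply Hmono with c; auto using le_add_r.
      * apply Hmono with d; auto using le_add_l.
Qed.

(** * Koenig's lemma for arithmetically definable trees *)

Section Konig.
Variable T : D -> Prop.
Hypothesis T_definable : definable M true (fun e => T (e 0%nat)).
Hypothesis T_tree : Tree T.
Hypothesis T_branching : FinBranching T.
Hypothesis T_infinite : Infinite T.

Lemma T_seq s : T s -> FinSeq s.
Proof. apply T_tree. Qed.

Lemma T_initseg s t : T s -> FinSeq t -> Initseg t s -> T t.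
Proof. intros. apply (proj2 T_tree) with s; auto. Qed.

Lemma T_restrict s l k : T s -> Lh s l -> k <= l -> exists t, T t /\ Lh t k /\ Initseg t s.
Proof.
  intros Hs Hl Hk. destruct (Initseg_restrict s l k) as (t & Ht & Htk & Hts); auto using T_seq.
  exists t. split; auto. now apply T_initseg with s.
Qed.

(** Collection merges the branching bounds of the nodes below [b] into one bound for the next level;
    numbers that are not nodes satisfy the collected condition vacuously. *)
Lemma bounded_below_length n :
  exists b, forall s, T s -> (exists l, l <= n /\ Lh s l) -> s < b.
Proof.
  revert n. apply induction_ari; [definable| |].
  - destruct empty_seq as (e & He & Hl). exists (e + 1). intros s Hs (l & Hl0 & Hsl).
    assert (E : l = 0) by (apply le_antisym; auto using zero_le). subst l.
    replace s with e; [apply lt_succ_diag|]. apply Initseg_eq with 0; auto using T_seq.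
    apply Initseg_of_entries; auto. intros i x Hx. exfalso. apply (lt_0_r i), Hl. eauto.
  - intros n [b Hb].
    destruct (collection_ari (fun s c => T s -> forall t, T t /\ ImmSucc s t -> t < c) b)
      as [c Hc].
    + unfold ImmSucc, Initseg. definable.
    + intros s c d H Hcd Hs t Ht. eapply lt_le_trans; [apply H|exact Hcd]; auto.
    + intros s _. destruct (classic (T s)) as [Hs|Hs].
      * destruct (T_branching s Hs) as [c Hc]. eauto.
      * exists 0. easy.
    + exists (b + c). intros s Hs (l & Hln & Hl).
      apply le_lt_eq in Hln as [Hln | ->].
      * eapply lt_le_trans; [apply Hb|apply le_add_r]; eauto.
      * destruct (T_restrict s (n + 1) n Hs Hl) as (t & Ht & Htn & Hts).
        { apply lt_le, lt_succ_diag. }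
        eapply lt_le_trans; [|apply le_add_l]. apply (Hc t); auto.
        -- apply Hb; auto. exists n. split; auto using le_refl.
        -- split; auto. split; auto. exists n. auto.
Qed.

(** [Infinite] speaks of large codes; finite branching converts this into large lengths, which
    extendibility of the root requires. *)
Lemma long_node n : exists t l, T t /\ Lh t l /\ n < l.
Proof.
  apply NNPP. intros H. destruct (bounded_below_length n) as [b Hb].
  destruct (T_infinite b) as (s & Hbs & Hs). destruct (FinSeq_length s (T_seq s Hs)) as [l Hl].
  apply (lt_irrefl b), lt_trans with s; auto. apply Hb; auto. exists l. split; auto.
  destruct (le_or_lt l n) as [|Hn]; auto. exfalso. eauto 6.
Qed.

Lemma definable_Extendible : definable M true (fun e => Extendible T (e 0%nat)).
Proof. unfold Extendible, Initseg. definable. Qed.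

Lemma extendible_root e : FinSeq e -> Lh e 0 -> Extendible T e.
Proof.
  intros He Hl.
  assert (Hi : forall t, Initseg e t).
  { intros t. apply Initseg_of_entries; auto. intros i x Hx. exfalso.
    apply (lt_0_r i), Hl. eauto. }
  split.
  - destruct (T_infinite 0) as (s & _ & Hs). now apply T_initseg with s.
  - intros n. destruct (long_node n) as (t & l & Ht & Htl & Hn). exists t, l. auto.
Qed.

(** If each immediate successor had only extensions of bounded length, collection over the
    successors, all below [b], would bound the extensions of [s]. *)
Lemma extendible_succ s : Extendible T s -> exists t, Extendible T t /\ ImmSucc s t.
Proof.
  intros [Hs Hext]. apply NNPP. intros Hno.
  destruct (FinSeq_length s (T_seq s Hs)) as [l Hl].
  destruct (T_branching s Hs) as [b Hb].
  destruct (collection_ari (fun t n => T t /\ ImmSucc s t ->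
      forall u k, T u /\ Initseg t u /\ Lh u k -> ~ n < k) b) as [n Hn].
  - unfold ImmSucc, Initseg. definable.
  - intros t c d H Hcd Ht u k Hu Hd. apply (H Ht u k Hu). eapply le_lt_trans; eauto.
  - intros t _. apply NNPP. intros H. apply Hno. exists t. 
    assert (Ht : T t /\ ImmSucc s t).
    { apply NNPP. intros H'. apply H. exists 0. tauto. }
    split; [split|]; try tauto. intros n. apply NNPP. intros H'. apply H. exists n.
    intros _ u k Hu Hk. apply H'. exists u, k. tauto.
  (* A length beyond [n + l + 1] violates the common bound [n] and leaves room for a prefix of
     length [l + 1]. *)
  - destruct (Hext (n + l + 1)) as (u & k & Hu & Hsu & Hk & Hlt).
    assert (Hlk : l + 1 <= k).
    { eapply le_trans; [|apply lt_le, Hlt]. apply le_intro with n. ring. }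
    destruct (T_restrict u k (l + 1) Hu Hk Hlk) as (t & Ht & Htl & Htu).
    assert (Hst : ImmSucc s t).
    { split; [|eauto]. apply Initseg_chain with u l (l + 1); auto using T_seq.
      apply lt_le, lt_succ_diag. }
    apply (Hn t) with u k; auto. eapply le_lt_trans; [|exact Hlt].
    apply le_intro with (l + 1). ring.
Qed.

(* [s] lies on the path that moves to the extendible successor of least code at every step. *)
Definition on_path s : Prop := Extendible T s /\
  forall r t, Extendible T r -> Extendible T t -> ImmSucc r t -> Initseg t s ->
    forall u, u < t -> ~ (Extendible T u /\ ImmSucc r u).

Lemma definable_on_path : definable M true (fun e => on_path (e 0%nat)).
Proof.
  pose proof definable_Extendible. unfold on_path, ImmSucc, Initseg. definable.
Qed.

Lemma extendible_initseg s t : Extendible T s -> FinSeq t -> Initseg t s -> Extendible T t.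
Proof.
  intros [Hs H] Ht Hts. split; [now apply T_initseg with s|]. intros n.
  destruct (H n) as (u & l & Hu & Hsu & Hl). exists u, l. split; auto. split; auto.
  now apply Initseg_trans with s.
Qed.

Lemma on_path_initseg s t : on_path s -> FinSeq t -> Initseg t s -> on_path t.
Proof.
  intros [Hs H] Ht Hts. split; [now apply extendible_initseg with s|].
  intros r u Hr Hu Hru Hut. apply H; auto. now apply Initseg_trans with t.
Qed.

Lemma on_path_seq s : on_path s -> FinSeq s.
Proof. intros [[Hs _] _]. now apply T_seq. Qed.

Lemma on_path_exists n : exists s, on_path s /\ Lh s n.
Proof.
  revert n. apply induction_ari.
  - pose proof definable_on_path. definable.
  - destruct empty_seq as (e & He & Hl). exists e. split; auto.
    split; [now apply extendible_root|]. intros r t _ _ (_ & l & _ & Ht) Hte. exfalso.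
    pose proof (Initseg_Lh _ _ _ _ Hte Ht Hl) as H. apply le_not_lt in H. apply H, zero_le.
  - intros n (s & Hs & Hn).
    destruct (extendible_succ s (proj1 Hs)) as (t0 & Ht0).
    destruct (least_ari (fun t => Extendible T t /\ ImmSucc s t) t0) as (t & [Ht Hst] & Hl); auto.
    { pose proof definable_Extendible. unfold ImmSucc, Initseg. definable. }
    assert (Htn : Lh t (n + 1)).
    { destruct Hst as (_ & k & Hk & Htk). now rewrite (Lh_unique s n k). }
    exists t. split; auto. split; auto. intros r u Hr Hu Hru Hut.
    assert (Hts : FinSeq t) by apply T_seq, Ht.
    assert (Hus : FinSeq u) by apply T_seq, Hu.
    assert (Hss : FinSeq s) by now apply on_path_seq.
    assert (Hrs : FinSeq r) by apply T_seq, Hr.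
    pose proof Hru as (Hiru & k & Hrk & Huk).
    pose proof (Initseg_Lh _ _ _ _ Hut Huk Htn) as Hkn.
    (* A shorter prefix [u] of [t] is already a prefix of [s]; otherwise [u] is [t], chosen as the
       least extendible successor of [s]. *)
    apply le_lt_eq in Hkn as [Hkn|Hkn].
    + apply (proj2 Hs r u Hr Hu Hru).
      apply Initseg_chain with t (k + 1) n; auto. apply Hst.
    + apply succ_inj in Hkn. subst k.
      assert (E : u = t) by now apply Initseg_eq with (n + 1).
      assert (E' : r = s).
      { apply Initseg_eq with n; auto. apply Initseg_chain with t n n; auto using le_refl.
        - now apply Initseg_trans with u.
        - apply Hst. }
      subst u r. exact Hl.
Qed.

(** By induction the restrictions to length [n] coincide, and of two different last steps the larger
    one violates minimality. *)
Lemma on_path_unique n s t : on_path s -> on_path t -> Lh s n -> Lh t n -> s = t.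
Proof.
  revert n s t.
  apply (induction_ari (fun n => forall s t, on_path s -> on_path t -> Lh s n -> Lh t n -> s = t)).
  - pose proof definable_on_path. definable.
  - intros s t Hs Ht Hsn Htn. apply Initseg_eq with 0; auto using on_path_seq.
    apply Initseg_of_entries; auto using on_path_seq. intros i x Hx. exfalso.
    apply (lt_0_r i), Hsn. eauto.
  - intros n IH s t Hs Ht Hsn Htn.
    assert (Hn : n <= n + 1) by apply lt_le, lt_succ_diag.
    destruct (Initseg_restrict s (n + 1) n) as (r & Hr & Hrn & Hrs); auto using on_path_seq.
    destruct (Initseg_restrict t (n + 1) n) as (r' & Hr' & Hrn' & Hrt); auto using on_path_seq.
    assert (Hpr : on_path r) by now apply on_path_initseg with s.
    assert (E : r = r') by (apply IH; auto; now apply on_path_initseg with t).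
    subst r'.
    assert (Hsucc : ImmSucc r s) by (split; eauto).
    assert (Htsucc : ImmSucc r t) by (split; eauto).
    destruct (lt_trichotomy s t) as [H|[H|H]]; auto; exfalso.
    + apply (proj2 Ht r t (proj1 Hpr) (proj1 Ht) Htsucc (Initseg_refl t) s H).
      split; [apply Hs|auto].
    + apply (proj2 Hs r s (proj1 Hpr) (proj1 Hs) Hsucc (Initseg_refl s) t H).
      split; [apply Ht|auto].
Qed.

(** The path is the union of the nodes satisfying [on_path]. Any two are comparable: the longer one,
    cut to the shorter length, equals the shorter by uniqueness. *)
Lemma konig : exists f, Path T f.
Proof.
  destruct (comprehension_ari (fun p => exists s, on_path s /\ Elem p s)) as [f Hf].
  { pose proof definable_on_path. definable. }
  assert (Hentry : forall s n i x, on_path s -> Lh s n -> i < n -> mem (pair i x) f -> Entry s i x).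
  { intros s n i x Hs Hn Hi Hx. apply Hf in Hx as (t & Ht & Hx).
    assert (Hxt : Entry t i x) by exact Hx. clear Hx.
    destruct (FinSeq_length t (on_path_seq t Ht)) as [m Hm].
    assert (Hres : forall r k l u y, on_path r -> Lh r k -> l <= k -> on_path u -> Lh u l ->
              Initseg u r).
    { intros r k l u y Hr Hk Hl Hu Hul.
      destruct (Initseg_restrict r k l) as (w & Hw & Hwl & Hwr); auto using on_path_seq.
      replace u with w; auto. apply on_path_unique with l; auto.
      now apply on_path_initseg with r. }
    destruct (le_or_lt m n) as [Hmn|Hmn].
    - apply (Hres s n m t 0); auto.
    - apply Initseg_entry with t n; auto using on_path_seq.
      apply (Hres t m n s 0); auto using lt_le. }
  exists f. split; [split; [|split]|].
  - intros p Hp. apply Hf in Hp as (s & Hs & Hp).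
    exact (proj1 (proj2 (on_path_seq s Hs)) p Hp).
  - intros n. destruct (on_path_exists (n + 1)) as (s & Hs & Hl).
    destruct (proj1 (Hl n) (lt_succ_diag n)) as [x Hx]. exists x. apply Hf. eauto.
  - intros n x y Hx Hy. destruct (on_path_exists (n + 1)) as (s & Hs & Hl).
    apply (FinSeq_fun s n); auto using on_path_seq; eauto using lt_succ_diag.
  - intros s [Hs Hsf]. destruct (FinSeq_length s Hs) as [n Hn].
    destruct (on_path_exists n) as (t & Ht & Htn).
    replace s with t; [apply Ht|]. symmetry. apply Initseg_eq with n; auto using on_path_seq.
    apply Initseg_of_entries; auto. intros i x Hx. apply Hentry with n; auto.
    apply Hn. eauto.
Qed.

End Konig.

Lemma ACA0_KL : KL_principle M.
Proof.
  intros X (HT & Hb & Hi & _). apply konig; auto. unfold InSet. definable.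
Qed.

(** The range of [g] is arithmetical and a binary node has at most two immediate successors, so
    Koenig's lemma covers the enumerated tree as well. *)
Lemma ACA0_WKL : WKL_principle M.
Proof.
  intros g (Hg & HT & Hbin & Hi & _). apply konig; auto; [unfold InRange; definable|].
  intros s Hs. assert (Hss : FinSeq s) by now apply HT.
  destruct (FinSeq_length s Hss) as [l Hl].
  destruct (seq_append s l 0 Hss Hl) as (t0 & Ht0 & Hl0 & He0).
  destruct (seq_append s l 1 Hss Hl) as (t1 & Ht1 & Hl1 & He1).
  exists (t0 + t1 + 1). intros t (Ht & Hst & k & Hk & Htk).
  rewrite (Lh_unique s k l Hk Hl) in Htk.
  assert (Htt : FinSeq t) by now apply HT.
  assert (Hcase : forall x t', FinSeq t' -> Lh t' (l + 1) ->
     (forall i y, Entry t' i y <-> Entry s i y \/ (i = l /\ y = x)) -> Entry t l x -> t = t').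
  { intros x t' Ht' Htl' He Hx. symmetry. apply Initseg_eq with (l + 1); auto.
    apply Initseg_of_entries; auto. intros i z Hz. apply He in Hz as [Hz|[-> ->]]; auto.
    now apply Hst. }
  destruct (proj1 (Htk l) (lt_succ_diag l)) as [x Hx].
  destruct (proj2 (Hbin t Ht) l x Hx) as [-> | ->].
  - rewrite (Hcase 0 t0); auto. apply le_add_r.
  - rewrite (Hcase 1 t1); auto. apply le_add_l.
Qed.

End ACA0.

End RCA0.

(** * From equivalence in all models to provability *)

Lemma equivalent_over_RCA0_intro (T U : theory) :
  (forall M, model RCA0 M -> model T M <-> model U M) -> equivalent_over RCA0 T U.
Proof.
  intros H. split; intros p Hp; apply completeness; intros M HM;
    (assert (HR : model RCA0 M) by (intros q Hq; apply HM; now left)).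
  - refine (proj1 (H M HR) _ p Hp). intros q Hq. apply HM. now right.
  - refine (proj2 (H M HR) _ p Hp). intros q Hq. apply HM. now right.
Qed.

Lemma model_axiom M p (P : Prop) :
  (forall v X, @sat M v X p <-> P) -> (model (axiom p) M <-> P).
Proof.
  intros H. split.
  - intros HM. apply (H (fun _ => zero) (fun _ => some_set)), HM. reflexivity.
  - intros HP q Hq v X. rewrite Hq. now apply H.
Qed.

Lemma model_ACA0_WKL M : model RCA0 M -> model ACA0 M <-> model (axiom Sigma01_WKL_ext_bd) M.
Proof.
  intros HM. change (RCA0_model M) in HM. rewrite (model_axiom M _ _ (sat_WKL M)). split.
  - apply ACA0_WKL.
  - intros H. apply ACA0_of_S01_comprehension. intros Y. now apply WKL_principle_comprehension.
Qed.

Lemma model_ACA0_KL M : model RCA0 M -> model ACA0 M <-> model (axiom KL_ext_bd) M.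
Proof.
  intros HM. change (RCA0_model M) in HM. rewrite (model_axiom M _ _ (sat_KL M)). split.
  - apply ACA0_KL.
  - intros H. apply ACA0_of_S01_comprehension. intros Y. now apply KL_principle_comprehension.
Qed.

Theorem corollary1p2 :
  equivalent_over RCA0 ACA0 (axiom Sigma01_WKL_ext_bd) /\
  equivalent_over RCA0 ACA0 (axiom KL_ext_bd) /\
  equivalent_over RCA0 (axiom Sigma01_WKL_ext_bd) (axiom KL_ext_bd).
Proof.
  split; [|split]; apply equivalent_over_RCA0_intro; intros M HM.
  - now apply model_ACA0_WKL.
  - now apply model_ACA0_KL.
  - now rewrite <- model_ACA0_WKL, model_ACA0_KL.
Qed.
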